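(* Let $d\ge1$, $R>0$, $0<U<1$, $a\in[0,1]$, $r_0>0$ and $C_0\in\mathbb{R}^d$, and let $(Y_n)_{n\ge0}$ be the Markov chain defined in the context, started from $Y_0=a\,\delta_{B(C_0,r_0)}$, with associated indicators $\varepsilon_k$, $k\ge1$. Then $$\mathbb{P}\big(\varepsilon_k=1\text{ infinitely often}\big)=0 .$$
   Context: $|A|$ is the Lebesgue measure of $A\subset\mathbb{R}^d$, $B(c,r)=\{y\in\mathbb{R}^d:\|y-c\|\le r\}$ (Euclidean norm), $\delta_A$ denotes the indicator function of the set $A$, and $\mathrm{Supp}(f)$ is the support of $f$. $A^R:=\{x\in\mathbb{R}^d:\min_{y\in A}\|x-y\|\le R\}$. $\mathcal{S}_c$ is the set of Borel measurable functions $f:\mathbb{R}^d\to[0,1]$ with compact support. The chain: given $Y_0$ (an element of $\mathcal{S}_c$), set $\Delta_0=\mathrm{Supp}(Y_0)$, and recursively for $n\ge0$ let $\mathcal{P}_n=\sigma(C_1,\dots,C_n,V_1,\dots,V_n,Y_0,\dots,Y_n)$ (so $\mathcal{P}_0=\sigma(Y_0)$). Conditionally on $\mathcal{P}_n$, $C_{n+1}$ is uniform on $\Delta_n^R$; $V_{n+1}$ is uniform on $[0,1]$, independent of $\mathcal{P}_n$ and $C_{n+1}$; $\varepsilon_{n+1}:=\mathbf{1}_{\{V_{n+1}\le Y_n(C_{n+1})\}}$; $$Y_{n+1}(\cdot)=Y_n(\cdot)+U\,\delta_{B(C_{n+1},R)}(\cdot)\big(\varepsilon_{n+1}-Y_n(\cdot)\big),\qquad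 \Delta_{n+1}=\mathrm{Supp}(Y_{n+1}).$$ In the degenerate case $Y_n\equiv0$ (where $\Delta_n^R=\emptyset$), $C_{n+1}$ is an arbitrary fixed point, $\varepsilon_{n+1}=0$ and $Y_{n+1}\equiv0$. *)

(* Defs.v *)
From mathcomp Require Import all_boot all_order all_algebra.
From mathcomp Require Import all_classical all_reals all_analysis.
From mathcomp Require Import measurable_realfun.

Set Implicit Arguments.
Unset Strict Implicit.
Unset Printing Implicit Defensive.

Import Order.TTheory GRing.Theory Num.Theory.
Import numFieldTopology.Exports numFieldNormedType.Exports.

Local Open Scope classical_set_scope.
Local Open Scope ring_scope.

Section Euclidean.
Context {R : realType} {d : nat}.
Implicit Types (c x y : 'rV[R]_d) (r : R) (A : set 'rV[R]_d).

(* The library norm on 'rV[R]_d is the sup norm; it induces the same topology,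
   so `open` and `closure` below are the usual ones. *)
Definition enorm x : R := Num.sqrt (\sum_(i < d) x ord0 i ^+ 2).

Definition eball c r : set 'rV[R]_d := [set y | enorm (y - c) <= r].

Definition supp (f : 'rV[R]_d -> R) : set 'rV[R]_d :=
  closure [set x | f x != 0].

(* A^r; for the compact sets A used here, "the minimal distance from x to A is
   at most r" means that some point of A is at distance at most r, and the
   enlargement of the empty set is empty. *)
Definition enlarge A r : set 'rV[R]_d :=
  [set x | exists2 y, A y & enorm (x - y) <= r].

End Euclidean.

Definition borel_rV (R : realType) (d : nat) :=
  g_sigma_algebraType (@open 'rV[R]_d).

Section Lebesgue.
Context {R : realType}.

(* Lebesgue measure on R^n as the n-fold product of the one-dimensional one:
   on tuples first, then transported to row vectors. *)
Fixpoint lebesgue_tuple (n : nat) : set (n.-tuple R) -> \bar R :=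
  if n is m.+1 then
    pushforward (@lebesgue_measure R \x lebesgue_tuple (n := m))%E
      (fun xt : R * m.-tuple R => [tuple of xt.1 :: xt.2])
  else \d_[tuple].

Definition lebesgue_rV (d : nat) : set (borel_rV R d) -> \bar R :=
  pushforward (lebesgue_tuple (n := d))
    (fun t => \row_(i < d) tnth t i : borel_rV R d).

End Lebesgue.

Section Chain.
Context {R : realType} {d : nat}.
Implicit Types (f : 'rV[R]_d -> R) (c x : 'rV[R]_d).

(* epsilon_{n+1} as a function of Y_n, C_{n+1}, V_{n+1}; it is 0 when Y_n = 0,
   including when V_{n+1} = 0. *)
Definition event_type f c (v : R) : bool :=
  ~~ `[< forall x, f x = 0 >] && (v <= f c).

Definition update (r U : R) f c (e : bool) : 'rV[R]_d -> R :=
  fun x => f x + U * \1_(eball c r) x * (e%:R - f x).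

(* Y_n built from Y_0, (C_k)_{k >= 1} and (V_k)_{k >= 1}; the values at index 0
   of c and v are not used. *)
Fixpoint chain_path (r U : R) (f0 : 'rV[R]_d -> R)
    (c : nat -> 'rV[R]_d) (v : nat -> R) (n : nat) : 'rV[R]_d -> R :=
  if n is m.+1 then
    let f := chain_path r U f0 c v m in
    update r U f (c n) (event_type f (c n) (v n))
  else f0.

(* Uniform law on (supp f)^r, or the point mass at cstar when f = 0. *)
Definition centre_law (r : R) (cstar : 'rV[R]_d) f (B : set (borel_rV R d)) :
    \bar R :=
  let D := enlarge (supp f) r in
  if `[< forall x, f x = 0 >] then \d_(cstar : borel_rV R d) B
  else (lebesgue_rV (B `&` D) / lebesgue_rV D)%E.

End Chain.

(* K w is, given the sub-sigma-algebra G, the conditional law of X: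
   for each measurable B, K ^~ B is a version of P(X \in B | G). *)
Definition conditional_law (disp disp' : measure_display)
    (T : measurableType disp) (E : measurableType disp') (R : realType)
    (P : probability T R) (G : set (set T)) (X : T -> E)
    (K : T -> set E -> \bar R) : Prop :=
  forall B : set E, measurable B ->
    (forall D : set (\bar R), measurable D -> G ((K ^~ B) @^-1` D)) /\
    (forall A : set T, G A ->
       P (A `&` X @^-1` B) = (\int[P]_(w in A) K w B)%E).

Section Process.
Context {R : realType} {d : nat} {disp : measure_display}
  {T : measurableType disp} {P : probability T R}.
Variables (r U : R) (cstar : 'rV[R]_d) (f0 : 'rV[R]_d -> R).
Variables (C : nat -> {RV P >-> borel_rV R d}) (V : nat -> {RV P >-> R}).

Definition Y (n : nat) (w : T) : 'rV[R]_d -> R :=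
  chain_path r U f0 (fun k => C k w) (fun k => V k w) n.

(* epsilon_{n+1} *)
Definition epsS (n : nat) (w : T) : bool :=
  event_type (Y n w) (C n.+1 w) (V n.+1 w).

(* P_n; the function-valued Y_i enters through its values Y_i(x). *)
Definition history (n : nat) : set (set T) :=
  <<s \bigcup_(i in [set i | (1 <= i <= n)%N])
        (preimage_set_system setT (C i) measurable `|`
         preimage_set_system setT (V i) measurable)
      `|` \bigcup_(i in [set i | (i <= n)%N]) \bigcup_(x in setT)
            preimage_set_system setT (fun w => Y i w x) measurable >>.

Definition history_centre (n : nat) : set (set T) :=
  <<s history n `|` preimage_set_system setT (C n.+1) measurable >>.

Record is_chain : Prop := IsChain {
  chain_centre : forall n, conditional_law P (history n) (C n.+1)
    (fun w => centre_law r cstar (Y n w));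
  chain_uniform : forall n (B : set R), measurable B ->
    distribution P (V n.+1) B = uniform_prob (@ltr01 R) B;
  chain_indep : forall n (A : set T) (B : set R),
    history_centre n A -> measurable B ->
    P (A `&` V n.+1 @^-1` B) = (P A * P (V n.+1 @^-1` B))%E
}.

End Process.

(* Main.v *)
(** Write [Y] for the current profile, [M] for its mass and [g c] for the integral
    of [1 - Y] over the ball [B(c, r)]. By symmetry of [|x - c| <= r], [M] is a
    nonnegative martingale; on an event ([eps = 1]) centred at [c] it jumps by
    exactly [U * g c]. Since [1 / (1 + m)] is bounded and strictly convex, its
    expectation along the chain telescopes and gives
    [sum_n E[(M' - M)^2 / ((1 + M)^2 (1 + M'))] <= 1]. A geometric inequality,
    [int Y g^2 >= kappa(K) int Y] whenever [int Y <= K], turns this into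
    [sum_n P(eps_(n+1) = 1, M_n <= K) < oo], so by Borel-Cantelli infinitely many
    events force [M_n] to exceed every [K] along the event times. As [M] decreases
    between events, [M_n] then exceeds [K] for all large [n], which by Markov's
    inequality has probability at most [M_0 / K] for every [K]. *)
Require Import Defs.
From HB Require Import structures.
From mathcomp Require Import all_boot all_order all_algebra.
From mathcomp Require Import all_classical all_reals all_analysis.
From mathcomp Require Import measurable_realfun ring lra.
Import Order.TTheory GRing.Theory Num.Theory.
Import numFieldTopology.Exports numFieldNormedType.Exports.
Local Open Scope classical_set_scope.
Local Open Scope ring_scope.

Set Implicit Arguments.
Unset Strict Implicit.
Unset Printing Implicit Defensive.

(** * Densities and conditional laws *)

(** Convergence of the martingale [M] would only force the jumps [U * g] to tend to 0 along the
    events; what has to be excluded is an infinity of events centred where the ball is almost full.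
    Given the past, an event is centred at [c] with density [Y c / L], where [L] is the volume of
    the support enlarged by [r]. Hence an event has probability [(1 / L) int Y], while the squared
    jump over events has mean [(U^2 / L) int Y g^2]. The volume [L] can be arbitrarily large, but it
    is common to both, which is why the comparison has the form [int Y g^2 >= kappa int Y]. The
    bound [int Y <= K] serves twice: in [kappa(K)], and to keep the weight
    [1 / ((1 + M)^2 (1 + M'))] away from 0. The geometric point is that a profile of bounded support
    which is nearly full somewhere must have a front, where a definite amount of mass sits next to a
    definite amount of vacancy. The conditional laws are given on rectangles only, through
    [P (A and X in B)], whereas the argument integrates joint functions of the past and of the new
    draw; the part on densities bridges this gap. *)

Section density.
Local Open Scope ereal_scope.
Context d (Z : measurableType d) (R : realType).
Variables (m nu : {measure set Z -> \bar R}) (k : Z -> R).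
Hypotheses (mk : measurable_fun setT k) (k0 : forall z, (0 <= k z)%R).
Hypothesis nuE : forall S, measurable S -> nu S = \int[m]_(z in S) (k z)%:E.

Import HBNNSimple.

(** Monotone convergence along simple functions on both sides reduces the identity to level sets,
    where it is [nuE]. *)
Lemma ge0_integral_density (H : Z -> \bar R) :
  measurable_fun setT H -> (forall z, 0 <= H z) ->
  \int[nu]_z H z = \int[m]_z (H z * (k z)%:E).
Proof.
move=> mH H0.
pose f_ := nnsfun_approx measurableT mH.
have f_H z : EFin \o f_^~ z @ \oo --> H z by exact: cvg_nnsfun_approx.
have mf n : measurable_fun setT (EFin \o f_ n).
  by apply/measurable_EFinP; exact: measurable_funPT.
transitivity (limn (fun n => \int[nu]_z (f_ n z)%:E)).
  rewrite -monotone_convergence//=.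
  - by apply: eq_integral => z _; apply/esym/cvg_lim => //; exact: f_H.
  - by move=> n z _; rewrite lee_fin.
  - by move=> z _ a b ab; rewrite lee_fin; exact/lefP/nd_nnsfun_approx.
transitivity (limn (fun n => \int[m]_z ((f_ n z)%:E * (k z)%:E))); last first.
  rewrite -monotone_convergence//=.
  - apply: eq_integral => z _; apply/cvg_lim => //.
    apply: cvgeZr => //; exact: f_H.
  - by move=> n; apply: emeasurable_funM; [exact: mf|exact/measurable_EFinP].
  - by move=> n z _; rewrite mule_ge0// lee_fin.
  - move=> z _ a b ab; rewrite lee_wpmul2r// lee_fin//.
    exact/lefP/nd_nnsfun_approx.
apply: congr_lim; apply/funext => n /=.
under eq_integral do rewrite fimfunE -fsumEFin//.
rewrite ge0_integral_fsum//; last 2 first.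
- by move=> y; exact/measurable_EFinP/measurable_funM.
- by move=> y x _; rewrite nnfun_muleindic_ge0.
under [RHS]eq_integral => z _.
  rewrite fimfunE -fsumEFin// ge0_mule_fsuml; last first.
    by move=> r; rewrite nnfun_muleindic_ge0.
  over.
rewrite ge0_integral_fsum//; last 2 first.
- by move=> r; apply: emeasurable_funM; apply/measurable_EFinP => //; exact: measurable_funM.
- by move=> r z _; rewrite mule_ge0 ?nnfun_muleindic_ge0// lee_fin.
apply: eq_fsbigr => y; rewrite inE => -[z _ yz].
have y0 : (0 <= y)%R by rewrite -yz.
rewrite integralZl_indic_nnsfun// integral_indic// setIT nuE//.
under [RHS]eq_integral do rewrite EFinM -muleA.
rewrite ge0_integralZl//.
- congr (_ * _).
  rewrite [LHS]integral_mkcond/=; apply: eq_integral => x _.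
  by rewrite patchE indicE muleC; case: ifPn => _; rewrite ?mule1 ?mule0.
- by apply: emeasurable_funM; exact/measurable_EFinP.
- by move=> x _; rewrite mule_ge0 ?lee_fin.
Qed.

End density.

Section density_sigma_additive.
Local Open Scope ereal_scope.
Context d (Z : measurableType d) (R : realType).
Variables (m : {measure set Z -> \bar R}) (k : Z -> R).
Hypotheses (mk : measurable_fun setT k) (k0 : forall z, (0 <= k z)%R).

(** Made into a measure so that it can be identified with another one by uniqueness on a generating
    class. *)
Definition density_measure (S : set Z) : \bar R := \int[m]_(z in S) (k z)%:E.

Let density0 : density_measure set0 = 0.
Proof. by rewrite /density_measure integral_set0. Qed.

Let density_ge0 S : 0 <= density_measure S.
Proof. by apply: integral_ge0 => z _; rewrite lee_fin. Qed.

Let density_sigma_additive : semi_sigma_additive density_measure.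
Proof.
move=> F mF tF mUF; rewrite /density_measure; apply: cvg_toP.
  apply: ereal_nondecreasing_is_cvgn => i j ij.
  by apply: lee_sum_nneg_natr => // l _ _; exact: density_ge0.
rewrite ge0_integral_bigcup//=.
- by apply: measurable_funTS; exact/measurable_EFinP.
- by move=> z _; rewrite lee_fin.
Qed.

Definition density_isMeasure := isMeasure.Build _ _ _ density_measure
  density0 density_ge0 density_sigma_additive.

End density_sigma_additive.

Section disintegration.
Local Open Scope ereal_scope.
Context d d' (X : measurableType d) (E : measurableType d') (R : realType).
Variables (mu : probability X R) (lam : {sigma_finite_measure set E -> \bar R}).
Variables (nu : {measure set (X * E) -> \bar R}) (h : X * E -> R).
Hypotheses (mh : measurable_fun setT h) (h0 : forall z, (0 <= h z)%R).
Hypothesis nuT : nu setT < +oo.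
Hypothesis nuX : forall A B, measurable A -> measurable B ->
  nu (A `*` B) = \int[mu]_(x in A) \int[lam]_(e in B) (h (x, e))%:E.

Let m : {measure set (X * E) -> \bar R} := mu \x lam.

(** Rectangles determine the finite measure [nu], so it coincides with the measure of density [h]
    with respect to [mu \x lam]; Tonelli then produces the iterated integral. *)
Lemma ge0_integral_disintegration (H : X * E -> \bar R) :
  measurable_fun setT H -> (forall z, 0 <= H z) ->
  \int[nu]_z H z = \int[mu]_x \int[lam]_e (H (x, e) * (h (x, e))%:E).
Proof.
move=> mH H0.
pose rho : {measure set (X * E) -> \bar R} :=
  HB.pack (density_measure m h) (density_isMeasure m mh h0).
have rhoX A B : measurable A -> measurable B -> nu (A `*` B) = rho (A `*` B).
  move=> mA mB; rewrite nuX// /rho/= /density_measure integral_mkcond/=.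
  have -> : (fun z => (h z)%:E) \_ (A `*` B) =
      (fun z => (h z * \1_(A `*` B) z)%:E).
    apply/funext => z; rewrite patchE indicE.
    by case: ifPn => _; rewrite ?mulr1 ?mulr0.
  rewrite fubini_tonelli1/=; last 2 first.
  - by apply/measurable_EFinP; apply: measurable_funM => //;
      apply: measurable_indic; exact: measurableX.
  - by move=> z; rewrite lee_fin mulr_ge0.
  rewrite integral_mkcond/=; apply: eq_integral => x _.
  rewrite patchE; case: ifPn => xA.
    rewrite integral_mkcond/=; apply: eq_integral => e _.
    by rewrite patchE indicE in_setX xA/=; case: ifPn; rewrite ?mulr1 ?mulr0.
  rewrite /fubini_F integral0_eq// => e _.
  by rewrite indicE in_setX (negbTE xA)/= mulr0.
have rhoE S : measurable S -> nu S = rho S.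
  move=> mS.
  pose C : set (set (X * E)) :=
    [set A `*` B | A in measurable & B in measurable].
  apply: (measure_unique C (fun=> setT)) => //.
  - exact: measurable_prod_measurableType.
  - move=> _ _ [A1 mA1 [B1 mB1 <-]] [A2 mA2 [B2 mB2 <-]].
    exists (A1 `&` A2); first exact: measurableI.
    by exists (B1 `&` B2); [exact: measurableI|rewrite setXI].
  - by move=> _; exists setT => //; exists setT => //; rewrite setXTT.
  - by rewrite bigcup_const.
  - by move=> _ [A mA [B mB <-]]; exact: rhoX.
rewrite (@ge0_integral_density _ _ _ m nu h)//.
rewrite fubini_tonelli1//.
- apply: emeasurable_funM => //; exact/measurable_EFinP.
- by move=> z; rewrite mule_ge0// lee_fin.
Qed.

End disintegration.

Section conditional_density.
Local Open Scope ereal_scope.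
Context d d' (T : measurableType d) (E : measurableType d') (R : realType).
Variables (P : probability T R) (G : set (set T)) (X : T -> E).
Variables (lam : {sigma_finite_measure set E -> \bar R}).
Variables (h : g_sigma_algebraType G * E -> R).
Hypotheses (GT : <<s G >> `<=` measurable) (mX : measurable_fun setT X).
Hypotheses (mh : measurable_fun setT h) (h0 : forall z, (0 <= h z)%R).
Hypothesis PX : forall A B, <<s G >> A -> measurable B ->
  P (A `&` X @^-1` B) = \int[P]_(w in A) \int[lam]_(e in B) (h (w, e))%:E.

(** The previous lemma is applied to the joint law of the past and of [X]: the mass of [A * B] under
    it is [P (A & X in B)], which [PX] expresses through [h]. *)
Lemma ge0_integral_conditional_density
    (H : g_sigma_algebraType G * E -> \bar R) :
  measurable_fun setT H -> (forall z, 0 <= H z) ->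
  \int[P]_w H (w, X w) = \int[P]_w \int[lam]_e (H (w, e) * (h (w, e))%:E).
Proof.
move=> mH H0.
(* The identity, seen as a map to the coarser sigma-algebra: its law is the restriction of [P] to
   [<<s G >>]. *)
pose i (w : T) : g_sigma_algebraType G := w.
have mi : measurable_fun setT i by move=> _ B mB; rewrite setTI; exact: GT.
pose im : {RV P >-> g_sigma_algebraType G} :=
  HB.pack i (isMeasurableFun.Build _ _ _ _ _ mi).
have mp : measurable_fun setT (fun w => (i w, X w)) by exact: measurable_fun_pair.
pose nu := pushforward P (fun w => (i w, X w)).
have mF D (f : g_sigma_algebraType G * E -> \bar R) : measurable D ->
    measurable_fun setT f -> (forall z, 0 <= f z) ->
    measurable_fun setT (fun w => \int[lam]_(e in D) f (w, e)).
  move=> mD mf f0.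
  pose f' (z : g_sigma_algebraType G * E) := f z * (\1_D z.2)%:E.
  have -> : (fun w => \int[lam]_(e in D) f (w, e)) = fubini_F lam f'.
    apply/funext => w; rewrite integral_mkcond; apply: eq_integral => e _.
    by rewrite patchE /f' indicE; case: ifPn => _; rewrite ?mule1 ?mule0.
  apply: measurable_fun_fubini_tonelli_F.
    apply: emeasurable_funM => //; apply/measurable_EFinP.
    by apply: measurableT_comp => //; exact: measurable_indic.
  by move=> z; rewrite mule_ge0// lee_fin.
transitivity (\int[nu]_z H z).
  by rewrite ge0_integral_pushforward.
rewrite (@ge0_integral_disintegration _ _ _ _ R (distribution P im) lam nu h)//=.
- rewrite ge0_integral_pushforward//=.
  + apply: (mF setT (fun z => H z * (h z)%:E)) => //.
      by apply: emeasurable_funM => //; exact/measurable_EFinP.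
    by move=> z; rewrite mule_ge0// lee_fin.
  + by move=> w _; apply: integral_ge0 => e _; rewrite mule_ge0// lee_fin.
- by rewrite /nu/= /pushforward preimage_setT probability_setT ltry.
- move=> A B mA mB.
  rewrite ge0_integral_pushforward//=.
  + by rewrite -PX.
  + apply: measurable_funTS.
    by apply: (mF B (EFin \o h)) => //; exact/measurable_EFinP.
  + by move=> w _; apply: integral_ge0 => e _; rewrite lee_fin.
Qed.

End conditional_density.

(** * Lebesgue measure on row vectors *)

Section with_sigma_finite.
Context d (Z : measurableType d) (R : realType).
Variables (m : {measure set Z -> \bar R}) (sfm : sigma_finite setT m).

(* The proof is an argument so that the sigma-finite structure can be inferred. *)
Definition with_sigma_finite of sigma_finite setT m : set Z -> \bar R := m.
Local Notation m' := (with_sigma_finite sfm).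

HB.instance Definition _ := Measure.copy m' m.
HB.instance Definition _ := Measure_isSigmaFinite.Build _ _ _ m' sfm.

End with_sigma_finite.

Section lebesgue_tuple_measure.
Local Open Scope ereal_scope.
Context {R : realType}.

Definition box_tuple n (a b : 'I_n -> R) : set (n.-tuple R) :=
  [set t | forall i : 'I_n, (a i <= tnth t i <= b i)%R].

Lemma measurable_box_tuple n a b : measurable (@box_tuple n a b).
Proof.
have -> : @box_tuple n a b =
    \big[setI/setT]_(i < n) ((@tnth n R ^~ i) @^-1` `[a i, b i]).
  apply/seteqP; split=> t.
    by move=> bt; rewrite -bigcap_seq => i _/=; rewrite in_itv/= bt.
  rewrite -bigcap_seq => bt i; have := bt i; rewrite /= in_itv/=; apply.
  by rewrite mem_index_enum.
apply: bigsetI_measurable => i _.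
rewrite -[X in measurable X]setTI; exact: measurable_tnth.
Qed.

Lemma sigma_finite_box_tuple n (m : {measure set (n.-tuple R) -> \bar R}) :
  (forall a b : 'I_n -> R, (forall i, a i <= b i)%R ->
    m (@box_tuple n a b) = (\prod_(i < n) (b i - a i))%:E) ->
  sigma_finite setT m.
Proof.
move=> mE.
exists (fun k => @box_tuple n (fun=> - k%:R)%R (fun=> k%:R)%R).
  apply/seteqP; split=> // t _.
  have [k tk] : exists k : nat, forall i, (`|tnth t i| <= k%:R)%R.
    exists (Num.truncn (\sum_(i < n) `|tnth t i|)%R).+1 => i.
    rewrite ltW// (le_lt_trans _ (truncnS_gt _))//.
    by rewrite (bigD1 i)//= lerDl sumr_ge0.
  by exists k => // i; rewrite -ler_norml.
move=> k; split; first exact: measurable_box_tuple.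
by rewrite mE ?ltry// => i; rewrite -subr_ge0 opprK addr_ge0.
Qed.

(** The two conjuncts go through the induction together: the volume of boxes yields the
    sigma-finiteness that the next product measure requires. *)
Lemma lebesgue_tuple_measure n : exists m : {measure set (n.-tuple R) -> \bar R},
  (m : set (n.-tuple R) -> \bar R) = @lebesgue_tuple R n /\
  (forall a b : 'I_n -> R, (forall i, a i <= b i)%R ->
    m (@box_tuple n a b) = (\prod_(i < n) (b i - a i))%:E).
Proof.
elim: n => [|n [m [mE mbox]]].
  exists (\d_[tuple] : {measure set (0.-tuple R) -> \bar R}); split=> // a b ab.
  by rewrite big_ord0 /= /dirac indicE mem_set// => i; have := ltn_ord i; rewrite ltn0.
pose sm : {sigma_finite_measure set (n.-tuple R) -> \bar R} :=
  with_sigma_finite (sigma_finite_box_tuple mbox).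
pose f (xt : R * n.-tuple R) := [tuple of xt.1 :: xt.2].
have mf : measurable_fun setT f by exact: measurable_cons.
unshelve (exists (pushforward (@lebesgue_measure R \x sm) f)); first exact: mf.
split.
  by rewrite /= -mE.
move=> a b ab.
rewrite /= /pushforward.
have -> : f @^-1` (@box_tuple n.+1 a b) =
    `[a ord0, b ord0] `*` @box_tuple n (a \o lift ord0) (b \o lift ord0).
  apply/seteqP; split=> [[x t] bxt|[x t] [/= + bt] i]/=.
    split=> /=; first by have := bxt ord0; rewrite in_itv.
    by move=> i; have := bxt (lift ord0 i); rewrite tnthS.
  rewrite in_itv/= => bx.
  by case: (unliftP ord0 i) => [j|] ->; rewrite ?tnthS//; exact: bt.
rewrite product_measure1E//=; last exact: measurable_box_tuple.
rewrite [X in _ * X](mbox (a \o lift ord0) (b \o lift ord0)); last first.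
  by move=> i; exact: ab.
rewrite big_ord_recl/= EFinM.
congr (_ * _).
have := @lebesgue_measure_itv R `[a ord0, b ord0]%R; rewrite /= lte_fin.
by have := ab ord0; rewrite le_eqVlt => /predU1P[->|ab0] ->;
  rewrite ?ltxx ?subrr ?ab0 ?EFinB.
Qed.

End lebesgue_tuple_measure.

(** * Borel measurability through coordinates *)

Section borel_rV_measurability.
Context {R : realType} {n : nat}.

Lemma open_rational_box (O : set 'rV[R]_n) (v : 'rV[R]_n) : open O -> O v ->
  exists pq : 'rV[rat]_n * 'rV[rat]_n,
    (forall i, ratr (pq.1 ord0 i) < v ord0 i < ratr (pq.2 ord0 i)) /\
    (forall u : 'rV[R]_n,
      (forall i, ratr (pq.1 ord0 i) < u ord0 i < ratr (pq.2 ord0 i)) -> O u).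
Proof.
move=> oO Ov; have [Q Qv QO] : nbhs v O by exact: open_nbhs_nbhs.
have /choice[pq pqE] : forall i, exists pq : rat * rat,
    (ratr pq.1 < v ord0 i < ratr pq.2) /\
    (forall x : R, ratr pq.1 < x < ratr pq.2 -> Q ord0 i x).
  move=> i; have /nbhs_ballP[e /= e0 eQ] := Qv ord0 i.
  have /rat_in_itvoo[p] : v ord0 i - e < v ord0 i by rewrite ltrBlDr ltrDl.
  rewrite in_itv/= => /andP[p1 p2].
  have /rat_in_itvoo[q] : v ord0 i < v ord0 i + e by rewrite ltrDl.
  rewrite in_itv/= => /andP[q1 q2].
  exists (p, q); split=> [|x /= /andP[px xq]]; first by rewrite /= p2 q1.
  apply: eQ; rewrite /ball/= ltr_norml; apply/andP; split; lra.
exists (\row_i (pq i).1, \row_i (pq i).2); split=> [i|u uE] /=.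
  by rewrite !mxE; have [] := pqE i.
apply: QO => a i; rewrite (ord1 a); apply: (pqE i).2.
by have := uE i; rewrite /= !mxE.
Qed.

(** An open set is the union of the countably many rational boxes that it contains, and the preimage
    of a box is a finite intersection of coordinate preimages. *)
Lemma measurable_fun_borel_rV d (X : measurableType d) (f : X -> borel_rV R n) :
  (forall i, measurable_fun setT (fun x => f x ord0 i)) -> measurable_fun setT f.
Proof.
move=> mf; apply: (@measurability _ _ X (borel_rV R n) setT f (@open 'rV[R]_n) erefl).
move=> _ [A oA <-].
rewrite setTI.
pose box (pq : 'rV[rat]_n * 'rV[rat]_n) : set X :=
  [set x | forall i, ratr (pq.1 ord0 i) < f x ord0 i < ratr (pq.2 ord0 i)].
have mbox pq : measurable (box pq).
  have -> : box pq = \big[setI/setT]_(i < n) ((fun x => f x ord0 i) @^-1`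
      `](ratr (pq.1 ord0 i)), (ratr (pq.2 ord0 i))[).
    apply/seteqP; split=> x.
      by move=> bx; rewrite -bigcap_seq => i _/=; rewrite in_itv/= bx.
    rewrite -bigcap_seq => bx i; have := bx i; rewrite /= in_itv/=; apply.
    by rewrite mem_index_enum.
  apply: bigsetI_measurable => i _.
  by rewrite -[X in measurable X]setTI; exact: mf.
(* [unpickle] enumerates the pairs of rational corners; a box is kept only if its preimage lies
   inside that of [A]. *)
have -> : f @^-1` A = \bigcup_k (if unpickle k is Some pq then
    if `[< box pq `<=` f @^-1` A >] then box pq else set0 else set0).
  apply/seteqP; split=> [x Ax|x [k _]].
    have [pq [pqx pqO]] := open_rational_box oA Ax.
    exists (pickle pq) => //; rewrite pickleK asboolT//.
    by move=> y; exact: pqO.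
  by case: unpickle => // pq; case: ifPn => // /asboolP; apply.
apply: bigcup_measurable => k _.
by case: unpickle => // pq; case: ifPn.
Qed.

Lemma measurable_coord i : measurable_fun setT (fun x : borel_rV R n => x ord0 i : R).
Proof.
apply: (measurability _ (RGenOpens.measurableE R)) => _ [_ [a [b ->] <-]].
rewrite setTI; apply: sub_sigma_algebra => /=.
have /continuousP := @coord_continuous R 1 n ord0 i.
by apply; exact: interval_open.
Qed.

End borel_rV_measurability.

Section lebesgue_rV_measure.
Local Open Scope ereal_scope.
Context {R : realType} {n : nat}.

Definition box_rV (a b : 'I_n -> R) : set (borel_rV R n) :=
  [set x | forall i, (a i <= x ord0 i <= b i)%R].

Lemma measurable_row_tuple :
  measurable_fun setT (fun t : n.-tuple R => \row_(i < n) tnth t i : borel_rV R n).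
Proof.
apply: measurable_fun_borel_rV => i; under eq_fun do rewrite mxE.
exact: measurable_tnth.
Qed.

Lemma measurable_box_rV a b : measurable (box_rV a b).
Proof.
have -> : box_rV a b = \big[setI/setT]_(i < n)
    ((fun x : borel_rV R n => x ord0 i) @^-1` `[a i, b i]).
  apply/seteqP; split=> x.
    by move=> bx; rewrite -bigcap_seq => i _/=; rewrite in_itv/= bx.
  rewrite -bigcap_seq => bx i; have := bx i; rewrite /= in_itv/=; apply.
  by rewrite mem_index_enum.
apply: bigsetI_measurable => i _.
by rewrite -[X in measurable X]setTI; exact: measurable_coord.
Qed.

(** Gives the bare set function [lebesgue_rV] a measure structure, together with the box volumes
    from which the volume bounds for balls are derived. *)
Lemma lebesgue_rV_measure :
  exists lam : {sigma_finite_measure set (borel_rV R n) -> \bar R},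
  (lam : set (borel_rV R n) -> \bar R) = @lebesgue_rV R n /\
  (forall a b : 'I_n -> R, (forall i, a i <= b i)%R ->
    lam (box_rV a b) = (\prod_(i < n) (b i - a i))%:E).
Proof.
have [m [mE mbox]] := @lebesgue_tuple_measure R n.
pose f (t : n.-tuple R) := \row_(i < n) tnth t i : borel_rV R n.
have [l lE'] : exists l : {measure set (borel_rV R n) -> \bar R},
    (l : set _ -> _) = pushforward m f.
  by unshelve (exists (pushforward m f)); first exact: measurable_row_tuple.
have lE a b : (forall i, a i <= b i)%R -> l (box_rV a b) = (\prod_(i < n) (b i - a i))%:E.
  move=> ab; rewrite -(mbox _ _ ab) lE'/= /pushforward; congr (m _).
  by apply/seteqP; split=> t bt i; have := bt i; rewrite /= mxE.
have sfl : sigma_finite setT l.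
  exists (fun k => box_rV (fun=> - k%:R)%R (fun=> k%:R)%R).
    apply/seteqP; split=> // x _.
    have [k xk] : exists k : nat, forall i, (`|x ord0 i| <= k%:R)%R.
      exists (Num.truncn (\sum_(i < n) `|x ord0 i|)%R).+1 => i.
      rewrite ltW// (le_lt_trans _ (truncnS_gt _))//.
      by rewrite (bigD1 i)//= lerDl sumr_ge0.
    by exists k => // i; rewrite -ler_norml.
  move=> k; split; first exact: measurable_box_rV.
  by rewrite lE ?ltry// => i; rewrite -subr_ge0 opprK addr_ge0.
exists (with_sigma_finite sfl); split => //.
by rewrite /with_sigma_finite lE' /lebesgue_rV /= mE.
Qed.

End lebesgue_rV_measure.

(** * Euclidean balls *)

Section euclidean_norm.
Context {R : realType} {n : nat}.
Implicit Types (x y c : 'rV[R]_n).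

Lemma enorm_ge0 x : 0 <= enorm x.
Proof. exact: sqrtr_ge0. Qed.

Lemma sqr_enorm x : enorm x ^+ 2 = \sum_(i < n) x ord0 i ^+ 2.
Proof. by rewrite sqr_sqrtr// sumr_ge0// => i _; exact: sqr_ge0. Qed.

Lemma enormBC x y : enorm (x - y) = enorm (y - x).
Proof.
by congr Num.sqrt; apply: eq_bigr => i _; rewrite !mxE -sqrrN opprB.
Qed.

Lemma enormZ a x : enorm (a *: x) = `|a| * enorm x.
Proof.
rewrite -sqrtr_sqr -sqrtrM ?sqr_ge0// mulr_sumr.
by congr Num.sqrt; apply: eq_bigr => i _; rewrite !mxE exprMn.
Qed.

Lemma enorm0 : enorm (0 : 'rV[R]_n) = 0.
Proof. by rewrite -(scale0r 0) enormZ normr0 mul0r. Qed.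

Lemma ler_coord_enorm x i : `|x ord0 i| <= enorm x.
Proof.
rewrite -sqrtr_sqr ler_wsqrtr// (bigD1 i)//= lerDl sumr_ge0// => j _.
exact: sqr_ge0.
Qed.

(** Cauchy-Schwarz, by expanding the sum of the squares of [enorm x * y_i - enorm y * x_i]; the
    factor [enorm x * enorm y] can be cancelled once the zero vectors are set aside. *)
Lemma ler_dot_enorm x y : \sum_(i < n) x ord0 i * y ord0 i <= enorm x * enorm y.
Proof.
have z0 (z : 'rV[R]_n) i : enorm z = 0 -> z ord0 i = 0.
  by move=> z0; apply/eqP; rewrite -normr_le0 -[leRHS]z0 ler_coord_enorm.
have [x0|x0] := eqVneq (enorm x) 0.
  by rewrite x0 mul0r big1// => i _; rewrite (z0 x i x0) mul0r.
have [y0|y0] := eqVneq (enorm y) 0.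
  by rewrite y0 mulr0 big1// => i _; rewrite (z0 y i y0) mulr0.
have xy0 : 0 < enorm x * enorm y by rewrite mulr_gt0// lt_neqAle eq_sym enorm_ge0 ?x0 ?y0.
rewrite -(ler_pM2l xy0).
have : 0 <= \sum_(i < n) (enorm x * y ord0 i - enorm y * x ord0 i) ^+ 2.
  by rewrite sumr_ge0// => i _; exact: sqr_ge0.
have -> : \sum_(i < n) (enorm x * y ord0 i - enorm y * x ord0 i) ^+ 2 =
    enorm x ^+ 2 * (\sum_(i < n) y ord0 i ^+ 2) +
    enorm y ^+ 2 * (\sum_(i < n) x ord0 i ^+ 2) -
    2 * (enorm x * enorm y) * (\sum_(i < n) x ord0 i * y ord0 i).
  rewrite !mulr_sumr -sumrN -!big_split/=; apply: eq_bigr => i _; ring.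
by rewrite -!sqr_enorm; set S := \sum_(i < n) _; lra.
Qed.

Lemma ler_enormD x y : enorm (x + y) <= enorm x + enorm y.
Proof.
rewrite -(@ler_pXn2r _ 2)// ?nnegrE ?addr_ge0 ?enorm_ge0//.
rewrite sqrrD !sqr_enorm.
under eq_bigr do rewrite mxE sqrrD.
rewrite big_split big_split/= lerD2r lerD2l sumrMnl lerMn2r/=.
exact: ler_dot_enorm.
Qed.

Lemma enlarge_eball c (rho r : R) : 0 <= rho -> 0 <= r ->
  enlarge (eball c rho) r = eball c (rho + r).
Proof.
move=> rho0 r0; apply/seteqP; split=> [x [y /= yc xy]|x /= xc].
  rewrite /eball/= (le_trans _ (lerD yc xy))//.
  by rewrite -[x - c](subrKA y) addrC ler_enormD.
have [rr|rr] := eqVneq (rho + r) 0.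
  exists x; last by rewrite subrr enorm0.
  move: xc; rewrite rr /eball/= => /le_trans; exact.
have rr0 : 0 < rho + r by rewrite lt_neqAle eq_sym rr addr_ge0.
(* The point that divides the segment from [c] to [x] in the ratio [rho : r]. *)
exists (c + (rho / (rho + r)) *: (x - c)).
  rewrite /eball/= addrAC subrr add0r enormZ ger0_norm ?divr_ge0 ?addr_ge0//.
  by rewrite mulrAC ler_pdivrMr// ler_wpM2l.
have -> : x - (c + (rho / (rho + r)) *: (x - c)) = (r / (rho + r)) *: (x - c).
  rewrite opprD addrA -{1}[x - c]scale1r -scalerBl; congr (_ *: _).
  by field.
rewrite enormZ ger0_norm ?divr_ge0 ?addr_ge0//.
by rewrite mulrAC ler_pdivrMr// ler_wpM2l.
Qed.

Lemma enlargeU A B r : enlarge (A `|` B) r = enlarge A r `|` @enlarge R n B r.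
Proof.
apply/seteqP; split=> x.
  by case=> y [Ay|By] xy; [left|right]; exists y.
by case=> -[y Ay xy]; exists y => //; [left|right].
Qed.

Lemma continuous_enormB c : continuous (fun x => enorm (x - c)).
Proof.
have cs : continuous (fun x : 'rV[R]_n => \sum_(i < n) (x - c) ord0 i ^+ 2).
  apply: continuous_big => [|i _ x]; first exact: add_continuous.
  under [X in continuous_at _ X]eq_fun do rewrite !mxE.
  apply: (@continuous_comp _ _ _ (fun x : 'rV[R]_n => x ord0 i)
    (fun z => (z - c ord0 i) ^+ 2)); first exact: coord_continuous.
  apply: (@continuous_comp _ _ _ (fun z => z - c ord0 i) (fun z => z ^+ 2)).
    by apply: cvgB; [exact: cvg_id|exact: cvg_cst].
  exact: exprn_continuous.
by move=> x; apply: (continuous_comp (cs x)); exact: sqrt_continuous.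
Qed.

Lemma closed_eball c r : closed (eball c r).
Proof.
apply: (@closed_comp _ _ _ [set z | z <= r]); last exact: closed_le.
by move=> x _; exact: continuous_enormB.
Qed.

Lemma measurable_enormB : measurable_fun setT
  (fun z : borel_rV R n * borel_rV R n => enorm ((z.1 : 'rV[R]_n) - z.2)).
Proof.
apply: measurableT_comp; first by apply: continuous_measurable_fun; exact: sqrt_continuous.
apply: measurable_sum => i.
under eq_fun do rewrite !mxE.
apply: measurable_funX; apply: measurable_funB.
  by apply: (measurableT_comp (measurable_coord i)).
by apply: (measurableT_comp (measurable_coord i)).
Qed.

End euclidean_norm.

(** * Volume bounds for balls and half balls *)

Section ball_volume.
Context {R : realType} {n : nat}.
Variables (lam : {sigma_finite_measure set (borel_rV R n.+1) -> \bar R}) (r : R).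
Hypothesis lam_box : forall a b : 'I_n.+1 -> R, (forall i, a i <= b i) ->
  lam (box_rV a b) = (\prod_(i < n.+1) (b i - a i))%:E.
Hypothesis r0 : 0 < r.
Implicit Types c : borel_rV R n.+1.

Lemma measurable_eball c s : measurable (eball c s : set (borel_rV R n.+1)).
Proof.
rewrite -[eball c s]setCK; apply: measurableC; apply: sub_sigma_algebra.
by rewrite /= openC; exact: closed_eball.
Qed.

Lemma eball_volume_le c s : 0 <= s -> (lam (eball c s) <= ((s *+ 2) ^+ n.+1)%:E)%E.
Proof.
move=> s0.
rewrite -[X in _ ^+ X]card_ord -prodr_const.
rewrite (eq_bigr (fun i => (c ord0 i + s) - (c ord0 i - s))); last by move=> i _; ring.
rewrite -lam_box; last by move=> i; lra.
apply: le_measure; rewrite ?inE; [exact: measurable_eball|exact: measurable_box_rV|].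
move=> x xc i; have := le_trans (ler_coord_enorm (x - c) i) xc.
by rewrite !mxE ler_norml => /andP[? ?]; apply/andP; split; lra.
Qed.

(* A part of the ball that lies strictly ahead of its centre in the first
   coordinate; the bound is chosen so that it contains a cube of side
   [r / (2 (n + 1))], whatever the centre. *)
Definition half_ball c : set (borel_rV R n.+1) :=
  [set y | enorm (y - c) <= r /\ c ord0 ord0 + r / (2 * n.+1%:R) <= y ord0 ord0].

Lemma measurable_half_ball c : measurable (half_ball c).
Proof.
apply: measurableI; first exact: (@measurable_eball c r).
set A := (X in measurable X); have -> : A =
  (fun y : borel_rV R n.+1 => y ord0 ord0) @^-1` `[(c ord0 ord0 + r / (2 * n.+1%:R)), +oo[.
  by apply/seteqP; split=> y; rewrite /A/= in_itv/= andbT.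
by rewrite -[X in measurable X]setTI; exact: measurable_coord.
Qed.

Lemma half_ball_volume_ge c :
  (((r / (2 * n.+1%:R)) ^+ n.+1)%:E <= lam (half_ball c))%E.
Proof.
set s := r / (2 * n.+1%:R).
have s0 : 0 < s by rewrite divr_gt0.
have sE : (s *+ 2) * n.+1%:R = r by rewrite /s; field.
rewrite -[X in _ ^+ X]card_ord -prodr_const.
(* The cube lies between [c + s] and [c + 2 s] in every coordinate. Its offsets from [c] are at most
   [2 s = r / (n + 1)], so the squared norm is at most [(n + 1) (2 s)^2 <= r^2]. *)
rewrite (eq_bigr (fun i => (c ord0 i + s *+ 2) - (c ord0 i + s))); last by move=> i _; ring.
rewrite -lam_box; last by move=> i; lra.
apply: le_measure; rewrite ?inE; [exact: measurable_box_rV|exact: measurable_half_ball|].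
move=> x xc; split; last by have /andP[] := xc ord0.
rewrite -(@ler_pXn2r _ 2)// ?nnegrE ?enorm_ge0 ?(ltW r0)// sqr_enorm.
apply: (@le_trans _ _ (\sum_(i < n.+1) (s *+ 2) ^+ 2)).
  apply: ler_sum => i _; rewrite !mxE ler_sqr ?nnegrE; last by lra.
    by have /andP[? ?] := xc i; lra.
  by have /andP[? ?] := xc i; lra.
rewrite sumr_const card_ord -sE exprMn -[leLHS]mulr_natr.
rewrite ler_wpM2l ?sqr_ge0//.
by rewrite -natrX ler_nat -{1}[n.+1]expn1 leq_pexp2l.
Qed.

Lemma eball_volume_lty c s : 0 <= s -> (lam (eball c s) < +oo)%E.
Proof. by move=> s0; rewrite (le_lt_trans (eball_volume_le c s0))// ltry. Qed.

Lemma eball_volume_gt0 c : (0 < lam (eball c r))%E.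
Proof.
apply: (@lt_le_trans _ _ (((r / (2 * n.+1%:R)) ^+ n.+1)%:E)).
  by rewrite lte_fin exprn_gt0// divr_gt0.
apply: (le_trans (half_ball_volume_ge c)); apply: le_measure; rewrite ?inE.
- exact: measurable_half_ball.
- exact: measurable_eball.
- by move=> x [].
Qed.

End ball_volume.

(** * Integrals over balls of radius [r] *)

Section ball_integral.
Context {R : realType} {n : nat}.
Variables (lam : {sigma_finite_measure set (borel_rV R n.+1) -> \bar R}) (r : R).
Hypothesis lam_box : forall a b : 'I_n.+1 -> R, (forall i, a i <= b i) ->
  lam (box_rV a b) = (\prod_(i < n.+1) (b i - a i))%:E.
Hypothesis r0 : 0 < r.
Implicit Types (c : borel_rV R n.+1) (f g : borel_rV R n.+1 -> R).

Definition ball_integral f c : \bar R := (\int[lam]_x (\1_(eball c r) x * f x)%:E)%E.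

Lemma measurable_ball_indic : measurable_fun setT
  (fun z : borel_rV R n.+1 * borel_rV R n.+1 => \1_(eball z.1 r) z.2 : R).
Proof.
pose K := [set z : borel_rV R n.+1 * borel_rV R n.+1 |
  enorm ((z.2 : 'rV[R]_n.+1) - z.1) <= r].
suff mK : measurable K.
  rewrite (_ : (fun z => _) = \1_K); first exact: measurable_indic.
  by apply/funext => z; rewrite !indicE; congr (_ %:R); apply/idP/idP; rewrite !inE.
have -> : K = ((fun z : borel_rV R n.+1 * borel_rV R n.+1 =>
    enorm ((z.1 : 'rV[R]_n.+1) - z.2)) \o (fun z => (z.2, z.1))) @^-1` `]-oo, r].
  by apply/seteqP; split=> z; rewrite /K/= in_itv.
rewrite -[X in measurable X]setTI; apply: measurableT_comp => //.
  exact: measurable_enormB.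
exact: measurable_fun_pair.
Qed.

Lemma measurable_eball_indic c : measurable_fun setT (\1_(eball c r) : borel_rV R n.+1 -> R).
Proof. by apply: measurable_indic; exact: measurable_eball. Qed.

Lemma measurable_ball_integral d (X : measurableType d) (F : X * borel_rV R n.+1 -> R) :
  measurable_fun setT F -> (forall z, 0 <= F z) ->
  measurable_fun setT (fun z : X * borel_rV R n.+1 => ball_integral (fun x => F (z.1, x)) z.2).
Proof.
move=> mF F0.
apply: (@measurable_fun_fubini_tonelli_F _ _ (X * borel_rV R n.+1)%type
  (borel_rV R n.+1) R lam (fun z => (\1_(eball z.1.2 r) z.2 * F (z.1.1, z.2))%:E)).
  apply/measurable_EFinP; apply: measurable_funM.
    have mg : measurable_fun setT (fun z : X * borel_rV R n.+1 * borel_rV R n.+1 =>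
        (z.1.2, z.2)).
      by apply: measurable_fun_pair => //; exact: measurableT_comp.
    exact: (measurableT_comp measurable_ball_indic mg).
  have mg : measurable_fun setT (fun z : X * borel_rV R n.+1 * borel_rV R n.+1 =>
      (z.1.1, z.2)).
    by apply: measurable_fun_pair => //; exact: measurableT_comp.
  exact: (measurableT_comp mF mg).
by move=> z; rewrite lee_fin mulr_ge0.
Qed.

Lemma ball_integral_ge0 f c : (forall x, 0 <= f x) -> (0 <= ball_integral f c)%E.
Proof. by move=> f0; apply: integral_ge0 => x _; rewrite lee_fin mulr_ge0. Qed.

Lemma ball_integral1 c : ball_integral (fun=> 1) c = lam (eball c r).
Proof.
rewrite /ball_integral; under eq_integral do rewrite mulr1.
by rewrite integral_indic ?setIT//; exact: measurable_eball.
Qed.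

Lemma le_ball_integral f g c : measurable_fun setT f -> measurable_fun setT g ->
  (forall x, 0 <= f x) -> (forall x, f x <= g x) ->
  (ball_integral f c <= ball_integral g c)%E.
Proof.
move=> mf mg f0 fg; apply: ge0_le_integral => //.
- by move=> x _; rewrite lee_fin mulr_ge0.
- by apply/measurable_EFinP/measurable_funM => //; exact: measurable_eball_indic.
- by apply/measurable_EFinP/measurable_funM => //; exact: measurable_eball_indic.
- by move=> x _; rewrite lee_fin ler_wpM2l.
Qed.

Lemma ball_integralD f g c : measurable_fun setT f -> measurable_fun setT g ->
  (forall x, 0 <= f x) -> (forall x, 0 <= g x) ->
  ball_integral (fun x => f x + g x) c = (ball_integral f c + ball_integral g c)%E.
Proof.
move=> mf mg f0 g0; rewrite /ball_integral.
under eq_integral do rewrite mulrDr EFinD.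
rewrite ge0_integralD//.
- by move=> x _; rewrite lee_fin mulr_ge0.
- by apply/measurable_EFinP/measurable_funM => //; exact: measurable_eball_indic.
- by move=> x _; rewrite lee_fin mulr_ge0.
- by apply/measurable_EFinP/measurable_funM => //; exact: measurable_eball_indic.
Qed.

Lemma ball_integral_fin_num f c : measurable_fun setT f ->
  (forall x, 0 <= f x <= 1) -> ball_integral f c \is a fin_num.
Proof.
move=> mf f01; have f0 x : 0 <= f x by have /andP[] := f01 x.
rewrite ge0_fin_numE ?ball_integral_ge0//.
apply: (@le_lt_trans _ _ (ball_integral (fun=> 1) c)).
  by apply: le_ball_integral => // x; have /andP[] := f01 x.
by rewrite ball_integral1 (eball_volume_lty lam_box)// ltW.
Qed.

End ball_integral.

(** * The geometric inequality *)

Section interface_energy.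
Context {R : realType} {n : nat}.
Variables (lam : {sigma_finite_measure set (borel_rV R n.+1) -> \bar R}) (r : R).
Hypothesis lam_box : forall a b : 'I_n.+1 -> R, (forall i, a i <= b i) ->
  lam (box_rV a b) = (\prod_(i < n.+1) (b i - a i))%:E.
Hypothesis r0 : 0 < r.
Variables (f : borel_rV R n.+1 -> R) (S : R).
Hypothesis mf : measurable_fun setT f.
Hypothesis f01 : forall x, 0 <= f x <= 1.
Hypothesis fS : forall x, f x != 0 -> x ord0 ord0 <= S.

(** The function [g] of the overview. *)
Definition vacancy c : R := fine (ball_integral lam r (fun x => 1 - f x) c).

Definition half_ball_bound : R := (r / (2 * n.+1%:R)) ^+ n.+1.
(** One entry for each case of [interface_energy], with [eta = half_ball_bound / 2]. Vacancy above
    [eta] everywhere gives the factor [eta^2]; otherwise a half ball contributes [eta^3], which is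
    at least [(eta^3 / K) int f]. *)
Definition interface_const (K : R) : R :=
  Num.min ((half_ball_bound / 2) ^+ 2) ((half_ball_bound / 2) ^+ 3 / K).

Let f0 x : 0 <= f x. Proof. by have /andP[] := f01 x. Qed.
Let f1 x : 0 <= 1 - f x. Proof. by have /andP[] := f01 x; lra. Qed.
Let f2 x : 0 <= 1 - f x <= 1. Proof. by have /andP[] := f01 x; lra. Qed.
Let mf1 : measurable_fun setT (fun x => 1 - f x).
Proof. exact: measurable_funB. Qed.

Lemma measurable_vacancy : measurable_fun setT vacancy.
Proof.
apply: measurableT_comp => //.
have m1 : measurable_fun setT (fun z : borel_rV R n.+1 * borel_rV R n.+1 => 1 - f z.2).
  by apply: measurable_funB => //; exact: measurableT_comp.
have mg : measurable_fun setT (fun c : borel_rV R n.+1 => (point : borel_rV R n.+1, c)).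
  exact: measurable_fun_pair.
exact: (measurableT_comp (measurable_ball_integral lam r m1 (fun z => f1 z.2)) mg).
Qed.

Let q := half_ball_bound.
Let eta := q / 2.
Let q0 : 0 < q. Proof. by rewrite exprn_gt0// divr_gt0. Qed.

Let vacancyE c : (vacancy c)%:E = ball_integral lam r (fun x => 1 - f x) c.
Proof. by rewrite fineK// (ball_integral_fin_num lam_box). Qed.

Let vacancy_ge0 c : 0 <= vacancy c.
Proof. by rewrite -lee_fin vacancyE ball_integral_ge0. Qed.

(** When the first coordinate of [c] exceeds [S + r], the ball misses all points where [f] is
    nonzero, and the vacancy is the full volume of the ball, at least [q = 2 eta]. *)
Let low_vacancy_coord c : vacancy c <= eta -> c ord0 ord0 <= S + r.
Proof.
move=> gc; apply: contrapT => /negP; rewrite -ltNge => Sc.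
have : (q%:E <= eta%:E)%E; last by rewrite lee_fin /eta; have := q0; lra.
apply: (le_trans (half_ball_volume_ge lam_box r0 c)).
apply: (@le_trans _ _ (lam (eball c r))).
  by apply: le_measure; rewrite ?inE; 
    [exact: measurable_half_ball|exact: measurable_eball|move=> x []].
rewrite -(ball_integral1 lam) (le_trans _ (_ : (vacancy c)%:E <= eta%:E)%E)//.
rewrite vacancyE /ball_integral le_eqVlt; apply/orP; left; apply/eqP.
apply: eq_integral => x _; rewrite indicE; case: (boolP (x \in _)); last by rewrite !mul0r.
rewrite inE => xc; congr (_ * _)%:E.
suff -> : f x = 0 by rewrite subr0.
apply: contrapT => /eqP /fS xS.
have := le_trans (ler_coord_enorm (x - c) ord0) xc.
by rewrite !mxE ler_norml => /andP[? ?]; lra.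
Qed.

(* Either the vacancy exceeds [eta] everywhere, or we take a point [c] of vacancy
   at most [eta] whose first coordinate is almost maximal: the half ball of [c] is
   then ahead of all such points, so the vacancy exceeds [eta] on it, while it
   carries mass at least [eta]. *)
Lemma interface_energy K : 0 < K -> (\int[lam]_x (f x)%:E <= K%:E)%E ->
  ((interface_const K)%:E * \int[lam]_x (f x)%:E <=
   \int[lam]_x (f x * vacancy x ^+ 2)%:E)%E.
Proof.
move=> K0 fK.
have eta0 : 0 < eta by rewrite divr_gt0.
have if0 : (0 <= \int[lam]_x (f x)%:E)%E by apply: integral_ge0 => x _; rewrite lee_fin.
have mfv : measurable_fun setT (fun x => (f x * vacancy x ^+ 2)%:E).
  apply/measurable_EFinP; apply: measurable_funM => //.
  by apply: measurable_funX; exact: measurable_vacancy.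
have [[c0 Gc0]|noG] := pselect (exists c, vacancy c <= eta); last first.
  apply: (@le_trans _ _ ((eta ^+ 2)%:E * \int[lam]_x (f x)%:E)%E).
    by rewrite lee_wpmul2r// lee_fin ge_min lexx.
  rewrite -ge0_integralZl_EFin ?sqr_ge0//; last 2 first.
  - by move=> x _; rewrite lee_fin.
  - exact/measurable_EFinP.
  apply: ge0_le_integral => //.
  - by move=> x _; rewrite -EFinM lee_fin mulr_ge0 ?sqr_ge0.
  - by under eq_fun do rewrite -EFinM; apply/measurable_EFinP; exact: measurable_funM.
  move=> x _; rewrite -EFinM lee_fin mulrC ler_wpM2l//.
  rewrite ler_sqr ?nnegrE ?(ltW eta0)// leNgt; apply/negP => /ltW gx.
  by apply: noG; exists x.
pose A := [set (c : borel_rV R n.+1) ord0 ord0 | c in [set c | vacancy c <= eta]].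
have supA : has_sup A.
  split; first by exists (c0 ord0 ord0); exists c0.
  by exists (S + r) => _ [c gc <-]; exact: low_vacancy_coord.
(* The slack in the supremum is the offset in the definition of [half_ball], so the points of [Q]
   have first coordinate strictly beyond [sup A]. *)
have rho0 : 0 < r / (2 * n.+1%:R) by rewrite divr_gt0.
have [_ [c Gc <-] cA] := sup_adherent rho0 supA.
pose Q : set (borel_rV R n.+1) := half_ball r c.
have mQ : measurable Q by exact: measurable_half_ball.
have mI : measurable_fun setT (\1_Q : borel_rV R n.+1 -> R) by exact: measurable_indic.
have QG x : Q x -> eta <= vacancy x.
  move=> [_ cx]; rewrite leNgt; apply/negP => /ltW xG.
  have : x ord0 ord0 <= sup A by apply: ub_le_sup; [exact: supA.2|exists x].
  by apply/negP; rewrite -ltNge (lt_le_trans _ cx)// -ltrBlDr.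
(* [Q] has volume at least [q = 2 eta], and the part of it that [f] leaves empty is at most the
   vacancy of [c], hence at most [eta]. *)
have IQ : (eta%:E <= \int[lam]_x (\1_Q x * f x)%:E)%E.
  have : (q%:E <= \int[lam]_x (\1_Q x * f x)%:E + eta%:E)%E; last first.
    by rewrite -leeBlDr// -EFinB; apply: le_trans; rewrite lee_fin /eta; lra.
  apply: (le_trans (half_ball_volume_ge lam_box r0 c)).
  have -> : lam Q = (\int[lam]_x ((\1_Q x * f x)%:E + (\1_Q x * (1 - f x))%:E))%E.
    rewrite -[in LHS](setIT Q) -integral_indic//; apply: eq_integral => x _.
    by rewrite -EFinD; congr (_%:E); ring.
  rewrite ge0_integralD//; last 4 first.
  - by move=> x _; rewrite lee_fin mulr_ge0.
  - by apply/measurable_EFinP; exact: measurable_funM.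
  - by move=> x _; rewrite lee_fin mulr_ge0.
  - by apply/measurable_EFinP; exact: measurable_funM.
  rewrite leeD2l// (@le_trans _ _ (vacancy c)%:E)//.
  rewrite vacancyE; apply: ge0_le_integral => //.
  - by move=> x _; rewrite lee_fin mulr_ge0.
  - by apply/measurable_EFinP; exact: measurable_funM.
  - apply/measurable_EFinP; apply: measurable_funM => //.
    exact: measurable_eball_indic.
  - move=> x _; rewrite lee_fin ler_wpM2r// !indicE ler_nat.
    by case: (boolP (x \in Q)) => // /set_mem[xc _]; rewrite mem_set.
apply: (@le_trans _ _ (eta ^+ 3)%:E).
  apply: (@le_trans _ _ ((eta ^+ 3 / K)%:E * K%:E)%E); last by rewrite -EFinM divfK// gt_eqF.
  by rewrite lee_pmul// lee_fin ?ge_min ?lexx ?orbT//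
    le_min ?sqr_ge0/= divr_ge0 ?exprn_ge0 ?(ltW eta0) ?(ltW K0).
apply: (@le_trans _ _ ((eta ^+ 2)%:E * \int[lam]_x (\1_Q x * f x)%:E)%E).
  by rewrite exprSr EFinM lee_wpmul2l// lee_fin sqr_ge0.
rewrite -ge0_integralZl_EFin ?sqr_ge0//; last 2 first.
- by move=> x _; rewrite lee_fin mulr_ge0.
- by apply/measurable_EFinP; exact: measurable_funM.
apply: ge0_le_integral => //.
- by move=> x _; rewrite -EFinM lee_fin mulr_ge0 ?sqr_ge0// mulr_ge0.
- under eq_fun do rewrite -EFinM; apply/measurable_EFinP.
  by apply: measurable_funM => //; exact: measurable_funM.
move=> x _; rewrite -EFinM lee_fin indicE.
case: (boolP (x \in Q)) => [/set_mem/QG gx|_]; last by rewrite mul0r mulr0 mulr_ge0 ?sqr_ge0.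
by rewrite mul1r mulrC ler_wpM2l// ler_sqr ?nnegrE ?(ltW eta0).
Qed.

End interface_energy.

(** * Paths of the chain *)

Section chain_path_support.
Context {R : realType} {n : nat}.
Variables (r U a r0 : R) (C0 : 'rV[R]_n.+1).
Hypotheses (r_gt0 : 0 < r) (U_gt0 : 0 < U) (U_lt1 : U < 1).
Hypotheses (a_gt0 : 0 < a) (a_le1 : a <= 1) (r0_gt0 : 0 < r0).
Let Y0 : 'rV[R]_n.+1 -> R := fun x => a * \1_(eball C0 r0) x.
Variables (c : nat -> 'rV[R]_n.+1) (v : nat -> R).
Let Y := chain_path r U Y0 c v.
Let eps k := event_type (Y k) (c k.+1) (v k.+1).

Let Y0E : Y 0 = Y0. Proof. by []. Qed.
Let YSE k : Y k.+1 = update r U (Y k) (c k.+1) (eps k). Proof. by []. Qed.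

(** A pointwise convex combination of [f x] and of the event indicator, with weight [U] in the ball
    and 0 outside; bounds and positivity are read off from this form. *)
Lemma update_convexE f (b : 'rV[R]_n.+1) (e : bool) x : update r U f b e x =
  (1 - U * \1_(eball b r) x) * f x + U * \1_(eball b r) x * e%:R.
Proof. by rewrite /update; ring. Qed.

Let UI01 (b : 'rV[R]_n.+1) x : 0 <= U * \1_(eball b r) x < 1.
Proof.
rewrite indicE; case: (x \in _); last by rewrite mulr0 lexx ltr01.
by rewrite mulr1 U_lt1 ltW.
Qed.

Lemma chain_path01 k x : 0 <= Y k x <= 1.
Proof.
elim: k => [|k /andP[h0 h1]].
  rewrite Y0E /Y0 indicE; case: (x \in _); rewrite ?mulr1 ?mulr0 ?lexx ?ler01//.
  by rewrite a_le1 ltW.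
rewrite YSE update_convexE; have /andP[i0 i1] := UI01 (c k.+1) x.
move: (Y k x) (U * _) h0 h1 i0 i1 => y i h0 h1 i0 i1.
case: (eps k); rewrite ?mulr1 ?mulr0; apply/andP; split; nra.
Qed.

(** A step multiplies the value by at least [1 - U] before adding a nonnegative term. As [a > 0],
    the degenerate case of the chain therefore never occurs. *)
Lemma chain_path_center_gt0 k : 0 < Y k C0.
Proof.
elim: k => [|k h].
  rewrite Y0E /Y0 indicE mem_set ?mulr1//.
  by rewrite /eball/= subrr enorm0 ltW.
rewrite YSE update_convexE; have /andP[i0 i1] := UI01 (c k.+1) C0.
rewrite ltr_wpDr ?mulr_gt0 ?subr_gt0//.
by rewrite mulr_ge0.
Qed.

Lemma chain_path_neq_cst0 k : `[< forall x, Y k x = 0 >] = false.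
Proof.
by apply/asboolP => h; have := chain_path_center_gt0 k; rewrite h ltxx.
Qed.

Lemma event_typeE k : eps k = (v k.+1 <= Y k (c k.+1)).
Proof. by rewrite /eps /event_type chain_path_neq_cst0. Qed.

(** The initial ball together with the balls of the past events. The radii are parameters so that
    the support and its enlargement are two instances. *)
Fixpoint region (s t : R) (k : nat) : set 'rV[R]_n.+1 :=
  if k is m.+1 then region s t m `|` [set x | eps m /\ eball (c k) t x]
  else eball C0 s.

Lemma regionSE s t k :
  region s t k.+1 = region s t k `|` (if eps k then eball (c k.+1) t else set0).
Proof.
by rewrite /=; congr (_ `|` _); case: (eps k); apply/seteqP; split=> x // -[].
Qed.

(** Since [U < 1], a positive value never returns to 0; a zero value becomes positive exactly when
    an event covers the point. *)
Lemma chain_path_neq0 k : [set x | Y k x != 0] = region r0 r k.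
Proof.
elim: k => [|k IH].
  apply/seteqP; split=> x /=; rewrite Y0E /Y0 indicE.
    by case: (boolP (x \in _)) => [/set_mem//|_]; rewrite mulr0 eqxx.
  by move=> xC; rewrite mem_set// mulr1 gt_eqF.
rewrite [RHS]/= -IH; apply/seteqP; split=> x /=; rewrite YSE update_convexE.
  have [->|//] := eqVneq (Y k x) 0; last by left.
  rewrite mulr0 add0r indicE; case: (boolP (x \in _)) => [/set_mem xB|_]; last by rewrite mulr0 mul0r eqxx.
  by case: (eps k) => //; [right|rewrite mulr0 eqxx].
have /andP[i0 i1] := UI01 (c k.+1) x.
have /andP[h0 _] := chain_path01 k x.
case=> [y0|[e xB]].
  rewrite gt_eqF//; apply: ltr_wpDr; first by rewrite mulr_ge0.
  by rewrite mulr_gt0 ?subr_gt0// lt_neqAle eq_sym y0.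
rewrite e mulr1 gt_eqF//; apply: ltr_wpDl; first by rewrite mulr_ge0 ?subr_ge0 ?(ltW i1).
by rewrite indicE mem_set// mulr1.
Qed.

Lemma closed_region s t k : closed (region s t k).
Proof.
elim: k => [|k IH]; first exact: closed_eball.
rewrite regionSE; apply: closedU => //.
by case: (eps k); [exact: closed_eball|exact: closed0].
Qed.

Lemma supp_chain_path k : supp (Y k) = region r0 r k.
Proof.
by rewrite /supp chain_path_neq0; apply/esym/closure_id; exact: closed_region.
Qed.

Lemma enlarge_region s t u k : 0 <= s -> 0 <= t -> 0 <= u ->
  enlarge (region s t k) u = region (s + u) (t + u) k.
Proof.
move=> s0 t0 u0; elim: k => [|k IH]; first exact: enlarge_eball.
rewrite !regionSE enlargeU IH; congr (_ `|` _).
case: (eps k); first exact: enlarge_eball.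
by apply/seteqP; split=> x //= -[].
Qed.

(* The set Delta_k^r on which the next centre is uniform. *)
Definition reach k := region (r0 + r) (r + r) k.

Lemma enlarge_supp_chain_path k : enlarge (supp (Y k)) r = reach k.
Proof. by rewrite supp_chain_path enlarge_region// ltW. Qed.

Lemma subset_eball_reach k x : Y k x != 0 -> eball x r `<=` reach k.
Proof.
move=> yx; rewrite -enlarge_supp_chain_path => z zx.
by exists x => //; rewrite supp_chain_path -chain_path_neq0.
Qed.

Lemma reach_mem k x : Y k x != 0 -> reach k x.
Proof.
move=> yx; apply: (subset_eball_reach yx).
by rewrite /eball/= subrr enorm0 ltW.
Qed.

Lemma chain_path_bounded k : exists S, forall x, Y k x != 0 -> x ord0 ord0 <= S.
Proof.
suff [S h] : exists S, forall x, region r0 r k x -> x ord0 ord0 <= S.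
  by exists S => x yx; apply: h; rewrite -chain_path_neq0.
have ball (b : 'rV[R]_n.+1) t x : eball b t x -> x ord0 ord0 <= b ord0 ord0 + t.
  move=> xb; have := le_trans (ler_coord_enorm (x - b) ord0) xb.
  by rewrite !mxE ler_norml => /andP[? ?]; lra.
elim: k => [|k [S h]]; first by exists (C0 ord0 ord0 + r0) => x; exact: ball.
exists (Num.max S (c k.+1 ord0 ord0 + r)) => x /= [/h xS|[_ /ball xS]].
  by rewrite le_max xS.
by rewrite le_max xS orbT.
Qed.

Variable lam : {sigma_finite_measure set (borel_rV R n.+1) -> \bar R}.
Hypothesis lam_box : forall a b : 'I_n.+1 -> R, (forall i, a i <= b i) ->
  lam (box_rV a b) = (\prod_(i < n.+1) (b i - a i))%:E.

Lemma measurable_region s t k : measurable (region s t k : set (borel_rV R n.+1)).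
Proof.
elim: k => [|k IH]; first exact: measurable_eball.
rewrite regionSE; apply: measurableU => //.
by case: (eps k) => //; exact: measurable_eball.
Qed.

Lemma reach_volume_lty k : (lam (reach k) < +oo)%E.
Proof.
rewrite /reach; elim: k => [|k IH]; first by rewrite (eball_volume_lty lam_box)// addr_ge0// ltW.
rewrite regionSE.
have mB : measurable ((if eps k then eball (c k.+1) (r + r) else set0) : set (borel_rV R n.+1)).
  by case: (eps k) => //; exact: measurable_eball.
apply: (le_lt_trans (measureU2 lam (measurable_region _ _ k) mB)).
rewrite lte_add_pinfty//; case: (eps k); last by rewrite measure0 ltry.
by rewrite (eball_volume_lty lam_box)// addr_ge0// ltW.
Qed.

Lemma reach_volume_gt0 k : (0 < lam (reach k))%E.
Proof.
apply: (lt_le_trans (eball_volume_gt0 lam_box r_gt0 C0)).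
apply: le_measure; rewrite ?inE; [exact: measurable_eball|exact: measurable_region|].
by apply: subset_eball_reach; rewrite gt_eqF// chain_path_center_gt0.
Qed.

End chain_path_support.

(** * Joint measurability of the profile in the randomness and the point *)

Section chain_path_measurable.
Context {R : realType} {n : nat}.
Variables (r U a r0 : R) (C0 : 'rV[R]_n.+1).
Hypotheses (r_gt0 : 0 < r) (U_gt0 : 0 < U) (U_lt1 : U < 1).
Hypotheses (a_gt0 : 0 < a) (a_le1 : a <= 1) (r0_gt0 : 0 < r0).
Let Y0 : 'rV[R]_n.+1 -> R := fun x => a * \1_(eball C0 r0) x.
Context d (X : measurableType d).
Variables (c : nat -> X -> borel_rV R n.+1) (v : nat -> X -> R) (m : nat).
Hypothesis mc : forall k, (1 <= k <= m)%N -> measurable_fun setT (c k).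
Hypothesis mv : forall k, (1 <= k <= m)%N -> measurable_fun setT (v k).
Let Y k w := chain_path r U Y0 (c ^~ w) (v ^~ w) k.
Let eps k w := event_type (Y k w) (c k.+1 w) (v k.+1 w).

Let measurable_eps k : (k < m)%N ->
  measurable_fun setT (fun z : X * borel_rV R n.+1 => Y k z.1 z.2) ->
  measurable_fun setT (eps k).
Proof.
move=> km mY; rewrite (_ : eps k = fun w => v k.+1 w <= Y k w (c k.+1 w)); last first.
  by apply/funext => w; exact: (event_typeE r C0 U_gt0 U_lt1 a_gt0 r0_gt0).
apply: measurable_fun_ler; first exact: mv.
have mg : measurable_fun setT (fun w => (w, c k.+1 w)).
  by apply: measurable_fun_pair => //; exact: mc.
exact: (measurableT_comp mY mg).
Qed.

Let measurable_ball_at k : (1 <= k <= m)%N -> measurable_fun setT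
  (fun z : X * borel_rV R n.+1 => \1_(eball (c k z.1) r) z.2 : R).
Proof.
move=> km; have mg : measurable_fun setT (fun z : X * borel_rV R n.+1 => (c k z.1, z.2)).
  by apply: measurable_fun_pair => //; apply: measurableT_comp => //; exact: mc.
exact: (measurableT_comp (measurable_ball_indic r) mg).
Qed.

(** Only the draws at times 1 to [m] are assumed measurable, so this applies to [T] itself and also
    to [T] with the sigma-algebra of the past. *)
Lemma measurable_chain_path k : (k <= m)%N ->
  measurable_fun setT (fun z : X * borel_rV R n.+1 => Y k z.1 z.2).
Proof.
elim: k => [_|k IH km].
  by apply: measurable_funM => //; apply: measurableT_comp => //; exact: measurable_eball_indic.
have mY := IH (ltnW km).
apply: measurable_funD => //; apply: measurable_funM.
  by apply: measurable_funM => //; exact: measurable_ball_at.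
apply: measurable_funB => //.
apply: (measurableT_comp (f := fun b : bool => b%:R : R)) => //.
exact: (measurableT_comp (measurable_eps km mY) measurable_fst).
Qed.

Lemma measurable_event_type k : (k < m)%N -> measurable_fun setT (eps k).
Proof. by move=> km; apply: measurable_eps => //; apply: measurable_chain_path; exact: ltnW. Qed.

Lemma measurable_region_pair s t k : (k <= m)%N -> measurable
  [set z : X * borel_rV R n.+1 | region r U a r0 C0 (c ^~ z.1) (v ^~ z.1) s t k z.2].
Proof.
elim: k => [_|k IH km].
  rewrite -[X in measurable X]setTI; apply: (measurable_snd measurableT).
  exact: measurable_eball.
pose g := fun z : X * borel_rV R n.+1 => (z.2, c k.+1 z.1).
have mg : measurable_fun setT g.
  by apply: measurable_fun_pair => //; apply: measurableT_comp => //; exact: mc.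
have mB := measurableT_comp measurable_enormB mg measurableT (measurable_itv `]-oo, t]).
have mE := measurableT_comp (measurable_event_type km)
  (measurable_fst : measurable_fun [set: X * borel_rV R n.+1] _).
have {}mE := mE measurableT [set true] I.
have := measurableU _ _ (IH (ltnW km)) (measurableI _ _ mE mB).
congr measurable; apply/seteqP; split=> z.
  by case=> [?|[[_ e] [_ /=]]]; [left|rewrite in_itv/=; right].
by case=> [?|[e zc]]; [left|right; split=> //=; rewrite in_itv].
Qed.

End chain_path_measurable.

(** * Mass of a path and its balance *)

Section chain_mass.
Context {R : realType} {n : nat}.
Variables (r U a r0 : R) (C0 : 'rV[R]_n.+1).
Hypotheses (r_gt0 : 0 < r) (U_gt0 : 0 < U) (U_lt1 : U < 1).
Hypotheses (a_gt0 : 0 < a) (a_le1 : a <= 1) (r0_gt0 : 0 < r0).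
Let Y0 : 'rV[R]_n.+1 -> R := fun x => a * \1_(eball C0 r0) x.
Variables (c : nat -> borel_rV R n.+1) (v : nat -> R).
Let Y := chain_path r U Y0 c v.
Let eps k := event_type (Y k) (c k.+1) (v k.+1).
Variable lam : {sigma_finite_measure set (borel_rV R n.+1) -> \bar R}.
Hypothesis lam_box : forall a b : 'I_n.+1 -> R, (forall i, a i <= b i) ->
  lam (box_rV a b) = (\prod_(i < n.+1) (b i - a i))%:E.

Let Y01 k x : 0 <= Y k x <= 1. Proof. exact: chain_path01. Qed.
Let Y_ge0 k x : 0 <= Y k x. Proof. by have /andP[] := Y01 k x. Qed.

Lemma measurable_chain_path_fixed k :
  measurable_fun setT (Y k : borel_rV R n.+1 -> R).
Proof.
(* A single path is the case of a one-point parameter space. *)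
have mY := @measurable_chain_path R n r U a r0 C0 U_gt0 U_lt1 a_gt0 r0_gt0 _ unit
  (fun j _ => c j) (fun j _ => v j) k (fun _ _ => @measurable_cst _ _ _ _ _ _)
  (fun _ _ => @measurable_cst _ _ _ _ _ _) k (leqnn k).
exact: (measurableT_comp mY (measurable_pair1 tt)).
Qed.
Let mY := measurable_chain_path_fixed.

Definition chain_mass k : \bar R := \int[lam]_x (Y k x)%:E.

Lemma chain_mass_fin_num k : chain_mass k \is a fin_num.
Proof.
rewrite ge0_fin_numE; last by apply: integral_ge0 => x _; rewrite lee_fin.
have mD : measurable (reach r U a r0 C0 c v k : set (borel_rV R n.+1)).
  exact: measurable_region.
apply: le_lt_trans (@reach_volume_lty _ _ r U a r0 C0 r_gt0 r0_gt0 c v lam lam_box k).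
rewrite -(setIT (reach _ _ _ _ _ _ _ _)) -integral_indic//; apply: ge0_le_integral => //.
- by move=> x _; rewrite lee_fin.
- by apply/measurable_EFinP; exact: mY.
- by apply/measurable_EFinP; exact: measurable_indic.
move=> x _; rewrite lee_fin indicE; case: (boolP (x \in _)) => [_|].
  by have /andP[] := Y01 k x.
move=> /negP xD; rewrite leNgt; apply/negP => Yx; apply: xD; rewrite inE.
by apply: (reach_mem r_gt0 U_gt0 U_lt1 a_gt0 a_le1 r0_gt0); rewrite gt_eqF.
Qed.

(** The loss stands on the left, so that only integrals of nonnegative functions are added;
    [chain_mass_real] is the signed form. *)
Lemma chain_massS k :
  (chain_mass k.+1 + U%:E * ball_integral lam r (Y k) (c k.+1) =
   chain_mass k + (U * (eps k)%:R)%:E * lam (eball (c k.+1) r))%E.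
Proof.
rewrite /chain_mass /ball_integral.
have mI := measurable_eball_indic r (c k.+1).
rewrite -ge0_integralZl_EFin ?(ltW U_gt0)//; last 2 first.
- by move=> x _; rewrite lee_fin mulr_ge0.
- by apply/measurable_EFinP; apply: measurable_funM => //; exact: mY.
have -> : lam (eball (c k.+1) r) = (\int[lam]_x (\1_(eball (c k.+1) r) x)%:E)%E.
  by rewrite integral_indic ?setIT//; exact: measurable_eball.
rewrite -ge0_integralZl_EFin ?mulr_ge0 ?(ltW U_gt0)//; last exact/measurable_EFinP.
rewrite -!ge0_integralD//.
- apply: eq_integral => x _; rewrite -!EFinM -!EFinD; congr (_%:E).
  have -> : Y k.+1 x = (1 - U * \1_(eball (c k.+1) r) x) * Y k x +
    U * \1_(eball (c k.+1) r) x * (eps k)%:R by exact: update_convexE.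
  by move: (\1_(eball (c k.+1) r) x) (Y k x) => i y; ring.
- by move=> x _; rewrite lee_fin.
- by apply/measurable_EFinP; exact: mY.
- by move=> x _; rewrite -EFinM lee_fin !mulr_ge0// ltW.
- by apply/measurable_EFinP; apply: measurable_funM.
- by move=> x _; rewrite lee_fin.
- by apply/measurable_EFinP; exact: mY.
- by move=> x _; rewrite -EFinM lee_fin !mulr_ge0// ltW.
- by apply/measurable_EFinP; apply: measurable_funM => //; apply: measurable_funM => //.
Qed.

Lemma vacancyDball_integral k b :
  vacancy lam r (Y k) b + fine (ball_integral lam r (Y k) b) = fine (lam (eball b r)).
Proof.
have f1 x : 0 <= 1 - Y k x <= 1 by have /andP[] := Y01 k x; lra.
rewrite /vacancy -fineD ?(ball_integral_fin_num lam_box)//; last first.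
  by apply: measurable_funB => //; exact: mY.
congr fine; rewrite -ball_integralD//.
- by rewrite -ball_integral1; apply: eq_integral => x _; rewrite subrK.
- by apply: measurable_funB => //; exact: mY.
- by move=> x; have /andP[] := f1 x.
Qed.

Lemma chain_mass_real k : let m j := fine (chain_mass j) in
  m k.+1 = m k + U * (eps k)%:R * fine (lam (eball (c k.+1) r)) -
           U * fine (ball_integral lam r (Y k) (c k.+1)).
Proof.
move=> m; have := chain_massS k.
have fJ : ball_integral lam r (Y k) (c k.+1) \is a fin_num.
  by apply: (ball_integral_fin_num lam_box) => //; exact: mY.
have fV : lam (eball (c k.+1) r) \is a fin_num.
  by rewrite ge0_fin_numE// (eball_volume_lty lam_box)// ltW.
rewrite -(fineK (chain_mass_fin_num k.+1)) -(fineK (chain_mass_fin_num k)).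
rewrite -(fineK fJ) -(fineK fV) -!EFinM -!EFinD => -[] mE.
by apply: (addIr (U * fine (ball_integral lam r (Y k) (c k.+1)))); rewrite subrK.
Qed.

(* Tonelli and the symmetry of the kernel [|x - b| <= r]; this is why the mass is a
   martingale. *)
Lemma ball_integral_swap k :
  (\int[lam]_b ((\1_(reach r U a r0 C0 c v k) b)%:E * ball_integral lam r (Y k) b) =
   \int[lam]_b ((\1_(reach r U a r0 C0 c v k) b * Y k b)%:E * lam (eball b r)))%E.
Proof.
set D := reach _ _ _ _ _ _ _ _.
have mD : measurable (D : set (borel_rV R n.+1)) by exact: measurable_region.
have mI : measurable_fun setT (\1_D : borel_rV R n.+1 -> R) by exact: measurable_indic.
pose F (z : borel_rV R n.+1 * borel_rV R n.+1) :=
  (\1_D z.1 * (\1_(eball z.1 r) z.2 * Y k z.2))%:E.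
have mF : measurable_fun setT F.
  apply/measurable_EFinP; apply: measurable_funM.
    exact: (measurableT_comp mI measurable_fst).
  apply: measurable_funM; first exact: measurable_ball_indic.
  exact: (measurableT_comp (mY k) measurable_snd).
have F0 z : (0 <= F z)%E by rewrite lee_fin !mulr_ge0.
transitivity (\int[lam]_b fubini_F lam F b)%E.
  apply: eq_integral => b _; rewrite /fubini_F /ball_integral -ge0_integralZl_EFin//.
  - by move=> x _; rewrite lee_fin mulr_ge0.
  - apply/measurable_EFinP; apply: measurable_funM; last exact: mY.
    exact: measurable_eball_indic.
rewrite -fubini_tonelli1// fubini_tonelli2//.
apply: eq_integral => x _; rewrite /fubini_G.
transitivity (\int[lam]_b ((Y k x)%:E * (\1_(eball x r) b)%:E))%E.
  apply: eq_integral => b _; rewrite /F -EFinM/=; congr (_%:E).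
  (* Where [Y k x] is nonzero, the ball around [x] lies in [D], which absorbs the factor [\1_D b];
     elsewhere both sides vanish. *)
  have [->|Yx] := eqVneq (Y k x) 0; first by rewrite mul0r !mulr0.
  have xE : (x \in eball b r) = (b \in eball x r).
    by apply/idP/idP; rewrite !inE /eball/= enormBC.
  rewrite !indicE xE; case: (boolP (b \in eball x r)) => [/set_mem bx|_].
    have bD : b \in D.
      exact/mem_set/(subset_eball_reach r_gt0 U_gt0 U_lt1 a_gt0 a_le1 r0_gt0 Yx).
    by rewrite bD !mul1r mulr1.
  by rewrite mul0r !mulr0.
rewrite ge0_integralZl_EFin//; last by apply/measurable_EFinP; exact: measurable_eball_indic.
rewrite integral_indic ?setIT//; last exact: measurable_eball.
congr (_%:E * _)%E; have [->|Yx] := eqVneq (Y k x) 0; first by rewrite mulr0.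
rewrite indicE mem_set ?mul1r//.
exact: (reach_mem r_gt0 U_gt0 U_lt1 a_gt0 a_le1 r0_gt0 Yx).
Qed.

End chain_mass.

(** * The law of the chain *)

Lemma measurable_fun_invr_ge0 {R : realType} d (T : measurableType d) (f : T -> R) :
  measurable_fun setT f -> (forall x, 0 <= f x) ->
  measurable_fun setT (fun x => (f x)^-1).
Proof.
move=> mf f0; rewrite (_ : (fun x => _) = (@powR R)^~ (-1) \o f); last first.
  by apply/funext => x /=; rewrite powR_inv1.
by apply: measurableT_comp => //; exact: measurable_powR.
Qed.

(** * Integrating out the uniform threshold *)

Section uniform_threshold.
Context {R : realType} d (T : measurableType d) (P : probability T R).
Variables (G : set (set T)) (V : {RV P >-> R}).
Hypothesis GT : <<s G >> `<=` measurable.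
Hypothesis VU : forall B : set R, measurable B ->
  distribution P V B = uniform_prob (@ltr01 R) B.
Hypothesis VG : forall A (B : set R), <<s G >> A -> measurable B ->
  P (A `&` V @^-1` B) = (P A * P (V @^-1` B))%E.

Lemma uniform_prob_itvNy (y : R) : 0 <= y <= 1 ->
  uniform_prob (@ltr01 R) `]-oo, y]%classic = y%:E.
Proof.
move=> /andP[y0 y1]; rewrite /uniform_prob integral_uniform_pdf.
have -> : `]-oo, y]%classic `&` `[0, 1]%classic = `[0, y]%classic :> set R.
  apply/seteqP; split=> u /=; rewrite !in_itv/=.
    by move=> [uy /andP[u0 _]]; rewrite u0.
  by move=> /andP[u0 uy]; rewrite u0 (le_trans uy y1).
rewrite (eq_integral (fun=> 1%E)) => [|u].
  rewrite integral_cst//= mul1e; have := @lebesgue_measure_itv R `[0, y]%R.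
  rewrite /= lte_fin => ->.
  by move: y0; rewrite le_eqVlt => /predU1P[<-|->]; rewrite ?ltxx ?oppr0 ?adde0.
rewrite inE/= in_itv/= => /andP[u0 uy].
by rewrite /uniform_pdf u0 (le_trans uy y1) subr0 invr1.
Qed.

(** Independence says that, given [G], [V] has constant density 1 with respect to its own law;
    integrating over [V] then turns the indicator of [V <= y] into [y]. *)
Lemma integral_uniform_threshold (th y : g_sigma_algebraType G -> R) :
  measurable_fun setT th -> measurable_fun setT y ->
  (forall w, 0 <= th w) -> (forall w, 0 <= y w <= 1) ->
  (\int[P]_w (th w * (V w <= y w)%R%:R)%:E = \int[P]_w (th w * y w)%:E)%E.
Proof.
move=> mth my th0 y01.
pose H (z : g_sigma_algebraType G * R) := (th z.1 * (z.2 <= y z.1)%R%:R)%:E.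
have mle : measurable_fun setT (fun z : g_sigma_algebraType G * R => (z.2 <= y z.1)%R).
  by apply: measurable_fun_ler => //; exact: measurableT_comp.
have mb : measurable_fun setT (fun z : g_sigma_algebraType G * R => (z.2 <= y z.1)%R%:R : R).
  by apply: (measurableT_comp (f := fun b : bool => b%:R : R)).
have mH : measurable_fun setT H.
  by apply/measurable_EFinP; apply: measurable_funM => //; exact: measurableT_comp.
rewrite (@ge0_integral_conditional_density _ _ _ _ R P G V (distribution P V)
  (fun=> 1) GT _ _ _ _ H)//=.
- apply: eq_integral => w _; rewrite /H/=.
  under eq_integral do rewrite mule1 EFinM.
  rewrite ge0_integralZl_EFin//; last first.
    apply/measurable_EFinP.
    exact: (measurableT_comp mb (@measurable_pair1 _ _ (g_sigma_algebraType G) R w)).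
  rewrite EFinM; congr (_ * _)%E.
  rewrite -(uniform_prob_itvNy (y01 w)) -VU//.
  rewrite -(setIT `]-oo, _]%classic) -integral_indic//; apply: eq_integral => u _.
  by rewrite indicE mem_setE in_itv.
- move=> A B GA mB; rewrite VG//.
  under eq_integral do rewrite integral_cst// mul1e.
  by rewrite integral_cst 1?muleC//; exact: GT.
- by move=> z; rewrite lee_fin mulr_ge0.
Qed.

End uniform_threshold.

Section chain_law.
Context {R : realType} {n : nat} {disp : measure_display}
  {T : measurableType disp} {P : probability T R}.
Variables (r U a r0 : R) (C0 cstar : 'rV[R]_n.+1).
Variables (C : nat -> {RV P >-> borel_rV R n.+1}) (V : nat -> {RV P >-> R}).
Hypotheses (r_gt0 : 0 < r) (U_gt0 : 0 < U) (U_lt1 : U < 1).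
Hypotheses (a_gt0 : 0 < a) (a_le1 : a <= 1) (r0_gt0 : 0 < r0).
Let Y0 : 'rV[R]_n.+1 -> R := fun x => a * \1_(eball C0 r0) x.
Hypothesis chain : is_chain r U cstar Y0 C V.
Variable lam : {sigma_finite_measure set (borel_rV R n.+1) -> \bar R}.
Hypothesis lamE : (lam : set (borel_rV R n.+1) -> \bar R) = @lebesgue_rV R n.+1.
Hypothesis lam_box : forall a b : 'I_n.+1 -> R, (forall i, a i <= b i) ->
  lam (box_rV a b) = (\prod_(i < n.+1) (b i - a i))%:E.

Let Y k w := Y r U Y0 C V k w.
Let eps k w := epsS r U Y0 C V k w.
Let reach k w := reach r U a r0 C0 (fun j => C j w) (fun j => V j w) k.

(** The generators of [history k], named so that [T] can carry the sigma-algebra that they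
    generate. *)
Let gen (k : nat) : set (set T) :=
  \bigcup_(i in [set i | (1 <= i <= k)%N])
      (preimage_set_system setT (C i) measurable `|`
       preimage_set_system setT (V i) measurable)
    `|` \bigcup_(i in [set i | (i <= k)%N]) \bigcup_(x in setT)
          preimage_set_system setT (fun w => Y i w x) measurable.
(* [T] with the sigma-algebra P_k. *)
Let hT k := g_sigma_algebraType (gen k).

Let mC j k : (1 <= j <= k)%N -> measurable_fun setT (fun w : hT k => C j w).
Proof.
move=> jk _ B mB; rewrite setTI; apply: sub_sigma_algebra; left.
by exists j => //; left; exists B => //; rewrite setTI.
Qed.

Let mV j k : (1 <= j <= k)%N -> measurable_fun setT (fun w : hT k => V j w).
Proof.
move=> jk _ B mB; rewrite setTI; apply: sub_sigma_algebra; left.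
by exists j => //; right; exists B => //; rewrite setTI.
Qed.

Let mYT k : measurable_fun setT (fun z : T * borel_rV R n.+1 => Y k z.1 z.2).
Proof.
apply: (@measurable_chain_path R n r U a r0 C0 U_gt0 U_lt1 a_gt0 r0_gt0 _ T
  (fun j w => C j w) (fun j w => V j w) k) => // j _.
Qed.

Let mY k : measurable_fun setT (fun z : hT k * borel_rV R n.+1 => Y k z.1 z.2).
Proof.
apply: (@measurable_chain_path R n r U a r0 C0 U_gt0 U_lt1 a_gt0 r0_gt0 _ (hT k)
  (fun j w => C j w) (fun j w => V j w) k) => //.
- by move=> j jk; exact: mC.
- by move=> j jk; exact: mV.
Qed.

Let history_measurable k : <<s gen k >> `<=` measurable.
Proof.
apply: smallest_sub; first exact: sigma_algebra_measurable.
move=> A [[j jk [[B mB <-]|[B mB <-]]]|[j jk [x _ [B mB <-]]]].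
- exact: (measurable_funP (C j)).
- exact: (measurable_funP (V j)).
- exact: (measurableT_comp (mYT j)
    (@measurable_pair2 _ _ T (borel_rV R n.+1) x) measurableT mB).
Qed.

(** The density of [centre_law] with respect to [lam]. *)
Let h k (z : hT k * borel_rV R n.+1) : R :=
  \1_(reach k z.1) z.2 / fine (lam (reach k z.1)).

Let mh k : measurable_fun setT (@h k).
Proof.
pose D := [set z : hT k * borel_rV R n.+1 | reach k z.1 z.2].
have mD : measurable D.
  apply: (@measurable_region_pair R n r U a r0 C0 U_gt0 U_lt1 a_gt0 r0_gt0 _ (hT k)
    (fun j w => C j w) (fun j w => V j w) k) => //.
  - by move=> j jk; exact: mC.
  - by move=> j jk; exact: mV.
apply: measurable_funM.
  rewrite (_ : (fun z => _) = \1_D); first exact: measurable_indic.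
  by apply/funext => z; rewrite !indicE; congr (_ %:R); apply/idP/idP; rewrite !inE.
have mx := measurable_fun_xsection lam mD.
have mf : measurable_fun setT (fun w : hT k => (fine (lam (reach k w)))).
  apply: measurableT_comp => //; apply: eq_measurable_fun mx => w _ /=.
  congr (lam _); apply/seteqP; split=> x; rewrite /xsection/=.
    by move=> /set_mem.
  by move=> xD; exact: mem_set.
apply: (measurableT_comp (f := fun w : hT k => (fine (lam (reach k w)))^-1)) => //.
by apply: measurable_fun_invr_ge0 => // w; rewrite fine_ge0.
Qed.

Let h0 k z : 0 <= @h k z.
Proof. by rewrite divr_ge0// fine_ge0. Qed.

(** As [a > 0], [centre_law] is always in its uniform branch, and since the volume of [reach] is
    positive and finite, its extended-real quotient is the real one in [h]. *)
Lemma ge0_integral_centre k (H : hT k * borel_rV R n.+1 -> \bar R) :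
  measurable_fun setT H -> (forall z, 0 <= H z)%E ->
  (\int[P]_w H (w, C k.+1 w) = \int[P]_w \int[lam]_b (H (w, b) * (@h k (w, b))%:E))%E.
Proof.
move=> mH H0; apply: ge0_integral_conditional_density => // A B GA mB.
have [_ ->//] := chain_centre chain k mB.
apply: eq_integral => w _.
rewrite /centre_law chain_path_neq_cst0//.
rewrite enlarge_supp_chain_path// -lamE -/(reach k w).
have mD : measurable (reach k w : set (borel_rV R n.+1)) by exact: measurable_region.
have Doo : (lam (reach k w) < +oo)%E by exact: reach_volume_lty.
have D0 : (0 < lam (reach k w))%E by exact: reach_volume_gt0.
have DE : lam (reach k w) = (fine (lam (reach k w)))%:E by rewrite fineK// ge0_fin_numE.
under [RHS]eq_integral do rewrite /h/= EFinM.
have L0 : 0 < fine (lam (reach k w)) by rewrite -lte_fin -DE.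
rewrite ge0_integralZr//; last 2 first.
- by apply/measurable_EFinP; apply: measurable_funTS; exact: measurable_indic.
- by rewrite lee_fin invr_ge0 ltW.
rewrite integral_indic// setIC; congr (_ * _)%E.
by rewrite DE inver gt_eqF.
Qed.

Lemma integral_centre k (K : hT k * borel_rV R n.+1 -> R) :
  measurable_fun setT K -> (forall z, 0 <= K z) ->
  (\int[P]_w (K (w, C k.+1 w))%:E =
   \int[P]_w \int[lam]_b (K (w, b) * @h k (w, b))%:E)%E.
Proof.
move=> mK K0; rewrite (ge0_integral_centre (H := EFin \o K))//.
exact/measurable_EFinP.
Qed.

Let epsE k w : eps k w = (V k.+1 w <= Y k w (C k.+1 w)).
Proof. exact: (event_typeE r C0 U_gt0 U_lt1 a_gt0 r0_gt0). Qed.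

Let Y01 k w x : 0 <= Y k w x <= 1.
Proof. exact: chain_path01. Qed.

Lemma integral_event k (K : hT k * borel_rV R n.+1 -> R) :
  measurable_fun setT K -> (forall z, 0 <= K z) ->
  (\int[P]_w (K (w, C k.+1 w) * (eps k w)%:R)%:E =
   \int[P]_w \int[lam]_b (K (w, b) * Y k w b * @h k (w, b))%:E)%E.
Proof.
move=> mK K0.
(* These sets generate [history_centre k]: the threshold is integrated out first, with the new
   centre already known, and the centre afterwards. *)
pose G := <<s gen k >> `|` preimage_set_system setT (C k.+1) measurable.
pose i (w : g_sigma_algebraType G) : hT k * borel_rV R n.+1 := (w, C k.+1 w).
have mi : measurable_fun setT i.
  apply: measurable_fun_pair => [|_ B mB].
    by move=> _ B mB; rewrite setTI; apply: sub_sigma_algebra; left.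
  by apply: sub_sigma_algebra; right; exists B.
have GT : <<s G >> `<=` measurable.
  apply: smallest_sub; first exact: sigma_algebra_measurable.
  move=> A [/history_measurable//|[B mB <-]].
  exact: (measurable_funP (C k.+1)).
under eq_integral do rewrite epsE.
rewrite (@integral_uniform_threshold R _ T P G (V k.+1) GT _ _
  (K \o i) (fun w => Y k w (C k.+1 w)))//.
- rewrite -(integral_centre (K := fun z => K z * Y k z.1 z.2))//.
  + exact: measurable_funM.
  + by move=> z; rewrite mulr_ge0//; have /andP[] := Y01 k z.1 z.2.
- exact: (chain_uniform chain k).
- by move=> A B GA mB; apply: (chain_indep chain).
- exact: measurableT_comp.
- exact: (measurableT_comp (@mY k) mi).
- by move=> w /=.
Qed.

Let J k w b : R := fine (ball_integral lam r (Y k w) b).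
Let vol (b : borel_rV R n.+1) : R := fine (lam (eball b r)).
Let m k w : R := fine (chain_mass r U a r0 C0 (fun j => C j w) (fun j => V j w) lam k).
Let B : R := (r *+ 2) ^+ n.+1.

Let Y_ge0 k w x : 0 <= Y k w x.
Proof. by have /andP[] := Y01 k w x. Qed.

Let mYw k w : measurable_fun setT (Y k w : borel_rV R n.+1 -> R).
Proof. exact: measurable_chain_path_fixed. Qed.

Let vol_fin b : lam (eball b r) \is a fin_num.
Proof. by rewrite ge0_fin_numE// (eball_volume_lty lam_box)// ltW. Qed.

Let vol01 b : 0 <= vol b <= B.
Proof.
rewrite fine_ge0//= -lee_fin fineK//.
by apply: eball_volume_le => //; exact: ltW.
Qed.

Let J_fin k w b : ball_integral lam r (Y k w) b \is a fin_num.
Proof. by apply: (ball_integral_fin_num lam_box). Qed.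

Let J_ge0 k w b : 0 <= J k w b.
Proof. by rewrite fine_ge0// ball_integral_ge0. Qed.

Let g k w b : R := vacancy lam r (Y k w) b.

Let g_ge0 k w b : 0 <= g k w b.
Proof.
rewrite fine_ge0// ball_integral_ge0// => x.
by rewrite subr_ge0; have /andP[] := Y01 k w x.
Qed.

Let gJ k w b : g k w b + J k w b = vol b.
Proof. exact: vacancyDball_integral. Qed.

Let m_ge0 k w : 0 <= m k w.
Proof.
by apply: fine_ge0; apply: integral_ge0 => x _; rewrite lee_fin; exact: Y_ge0.
Qed.

Let mS k w : m k.+1 w = m k w + U * (eps k w)%:R * vol (C k.+1 w) - U * J k w (C k.+1 w).
Proof. exact: chain_mass_real. Qed.

Let mJ k : measurable_fun setT (fun z : hT k * borel_rV R n.+1 => J k z.1 z.2).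
Proof.
apply: measurableT_comp => //.
apply: (measurable_ball_integral lam r (F := fun z : hT k * borel_rV R n.+1 => Y k z.1 z.2)).
  exact: mY.
by move=> z.
Qed.

Let mvol : measurable_fun setT vol.
Proof.
apply: measurableT_comp => //.
have mb := measurable_ball_integral lam r
  (@measurable_cst _ _ (unit * borel_rV R n.+1)%type R setT 1)
  (fun=> ler01).
have := measurableT_comp mb (measurable_pair1 tt).
by under eq_fun do rewrite /= ball_integral1.
Qed.

Let mm k : measurable_fun setT (fun w : hT k => m k w).
Proof.
pose F (z : hT k * borel_rV R n.+1) := (Y k z.1 z.2)%:E.
have mF : measurable_fun setT (fubini_F lam F).
  apply: measurable_fun_fubini_tonelli_F; first by apply/measurable_EFinP; exact: mY.
  by move=> z; rewrite lee_fin.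
suff : measurable_fun setT (fine \o fubini_F lam F) by [].
exact: measurableT_comp.
Qed.

Let toT k d' (E : measurableType d') (f : hT k -> E) : measurable_fun setT f ->
  measurable_fun setT (f : T -> E).
Proof.
move=> mf _ A mA; apply: (@history_measurable k).
exact: mf.
Qed.

Let mmT k : measurable_fun setT (m k).
Proof. exact: (toT (@mm k)). Qed.

Let mepsT k : measurable_fun setT (eps k).
Proof.
by apply: (@measurable_event_type R n r U a r0 C0 U_gt0 U_lt1 a_gt0 r0_gt0 _ T
  (fun j w => C j w) (fun j w => V j w) k.+1).
Qed.

Let mJT k : measurable_fun setT (fun w => J k w (C k.+1 w)).
Proof.
have mi : measurable_fun setT (fun w : T => (w : hT k, C k.+1 w)).
  apply: measurable_fun_pair => // _ A mA; rewrite setTI.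
  exact: (@history_measurable k).
exact: (measurableT_comp (@mJ k) mi).
Qed.

Let mvolT k : measurable_fun setT (fun w => vol (C k.+1 w)).
Proof. exact: (measurableT_comp mvol). Qed.

(** The martingale property with a weight from the past, kept as an equality of nonnegative
    integrals. Given the past, and up to a common factor, the expected gain is the integral of
    [Y b * |B(b, r)|] over [reach] and the expected loss that of [ball_integral];
    [ball_integral_swap] equates them. *)
Lemma expected_increment0 k (th : hT k -> R) :
  measurable_fun setT th -> (forall w, 0 <= th w) ->
  (\int[P]_w (th w * (U * (eps k w)%:R * vol (C k.+1 w)))%:E =
   \int[P]_w (th w * (U * J k w (C k.+1 w)))%:E)%E.
Proof.
move=> mth th0.
have mth1 : measurable_fun setT (fun z : hT k * borel_rV R n.+1 => th z.1).
  exact: (measurableT_comp mth measurable_fst).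
rewrite (integral_centre (K := fun z => th z.1 * (U * J k z.1 z.2))); last 2 first.
- apply: measurable_funM => //; apply: measurable_funM => //; exact: mJ.
- by move=> z; rewrite !mulr_ge0// ltW.
transitivity (\int[P]_w ((th w * (U * vol (C k.+1 w))) * (eps k w)%:R)%:E)%E.
  by apply: eq_integral => w _; congr (_%:E); ring.
rewrite (integral_event (K := fun z => th z.1 * (U * vol z.2))); last 2 first.
- apply: measurable_funM => //; apply: measurable_funM => //.
  exact: (measurableT_comp mvol measurable_snd).
- by move=> z; have /andP[v0 _] := vol01 z.2; rewrite !mulr_ge0// ltW.
apply: eq_integral => w _ /=.
have swap := @ball_integral_swap R n r U a r0 C0 r_gt0 U_gt0 U_lt1 a_gt0 a_le1 r0_gt0
  (fun j => C j w) (fun j => V j w) lam k.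
have mD : measurable (reach k w : set (borel_rV R n.+1)) by exact: measurable_region.
have mI : measurable_fun setT (\1_(reach k w) : borel_rV R n.+1 -> R).
  exact: measurable_indic.
pose q := th w * U / fine (lam (reach k w)).
have q0 : 0 <= q by rewrite divr_ge0 ?fine_ge0// mulr_ge0// ltW.
transitivity (q%:E * \int[lam]_b ((\1_(reach k w) b * Y k w b)%:E * lam (eball b r)))%E.
  rewrite -ge0_integralZl_EFin//; last 2 first.
  - by move=> b _; rewrite mule_ge0// lee_fin mulr_ge0.
  - under eq_fun do rewrite -(fineK (vol_fin _)) -EFinM.
    by apply/measurable_EFinP; apply: measurable_funM => //; apply: measurable_funM.
  apply: eq_integral => b _; rewrite -(fineK (vol_fin b)) -!EFinM; congr (_%:E).
  by rewrite /q /h /vol/=; ring.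
rewrite -swap -ge0_integralZl_EFin//; last 2 first.
- by move=> b _; rewrite mule_ge0 ?lee_fin// ball_integral_ge0// => x; exact: Y_ge0.
- under eq_fun do rewrite -(fineK (J_fin _ _ _)) -EFinM.
  apply/measurable_EFinP; apply: measurable_funM => //.
  exact: (measurableT_comp (@mJ k) (@measurable_pair1 _ _ (hT k) (borel_rV R n.+1) w)).
apply: eq_integral => b _; rewrite -(fineK (J_fin k w b)) -!EFinM; congr (_%:E).
by rewrite /q /h /J/=; ring.
Qed.

Let integral_prob_cst (c : R) : (\int[P]_w c%:E)%E = c%:E.
Proof.
rewrite integral_cst//; transitivity (c%:E * 1)%E; last exact: mule1.
by congr (_ * _)%E; exact: probability_setT.
Qed.

Let bounded_fin_num (f : T -> R) c : measurable_fun setT f ->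
  (forall w, 0 <= f w <= c) -> (\int[P]_w (f w)%:E)%E \is a fin_num.
Proof.
move=> mf f0c; rewrite ge0_fin_numE; last first.
  by apply: integral_ge0 => w _; rewrite lee_fin; have /andP[] := f0c w.
apply: (@le_lt_trans _ _ (\int[P]_w c%:E)%E).
  apply: ge0_le_integral => //.
  - by move=> w _; rewrite lee_fin; have /andP[] := f0c w.
  - exact/measurable_EFinP.
  - by move=> w _; rewrite lee_fin; have /andP[] := f0c w.
by rewrite integral_prob_cst ltry.
Qed.

Let J_le k w b : J k w b <= B.
Proof. by have /andP[_] := vol01 b; have := gJ k w b; have := g_ge0 k w b; lra. Qed.

Let mUJ k : measurable_fun setT (fun w => U * J k w (C k.+1 w)).
Proof. exact: measurable_funM. Qed.

Let mepsR k : measurable_fun setT (fun w => (eps k w)%:R : R).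
Proof. exact: (measurableT_comp (f := fun b : bool => b%:R : R)). Qed.

Let mUvol k : measurable_fun setT (fun w => U * (eps k w)%:R * vol (C k.+1 w)).
Proof. by apply: measurable_funM => //; exact: measurable_funM. Qed.

Let UJ0 k w : 0 <= U * J k w (C k.+1 w).
Proof. by rewrite mulr_ge0// ltW. Qed.

Let Uvol0 k w : 0 <= U * (eps k w)%:R * vol (C k.+1 w).
Proof. by have /andP[v0 _] := vol01 (C k.+1 w); rewrite !mulr_ge0// ltW. Qed.

Lemma expected_mass k : (\int[P]_w (m k w)%:E = \int[P]_w (m 0 w)%:E)%E.
Proof.
elim: k => // k <-.
(* The expected loss is added to both sides and cancelled as a finite number, which avoids
   integrating a signed increment. *)
have X_fin : (\int[P]_w (1 * (U * J k w (C k.+1 w)))%:E)%E \is a fin_num.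
  apply: (@bounded_fin_num _ (U * B)); first exact: measurable_funM.
  by move=> w; rewrite mul1r UJ0/= ler_pM2l.
rewrite -[LHS](addeK _ X_fin) -[RHS](addeK _ X_fin); congr (_ - _)%E.
rewrite -[in RHS](expected_increment0 (th := fun=> 1))//.
rewrite -!ge0_integralD//.
- by apply: eq_integral => w _; rewrite -!EFinD; congr (_%:E); rewrite mS; ring.
- by move=> w _; rewrite lee_fin.
- exact/measurable_EFinP.
- by move=> w _; rewrite mul1r lee_fin.
- by under eq_fun do rewrite mul1r; exact/measurable_EFinP.
- by move=> w _; rewrite lee_fin.
- exact/measurable_EFinP.
- by move=> w _; rewrite mul1r lee_fin.
- by under eq_fun do rewrite mul1r; exact/measurable_EFinP.
Qed.

(** * The bounded potential and its telescoping sum *)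

Let psi k w : R := (1 + m k w)^-1.
Let inc k w : R := (m k.+1 w - m k w) ^+ 2 * psi k w ^+ 2 * psi k.+1 w.

Let psi01 k w : 0 <= psi k w <= 1.
Proof.
have m0 : 1 <= 1 + m k w by rewrite lerDl.
by rewrite invr_ge0 (le_trans ler01 m0)/= invf_le1// (lt_le_trans ltr01 m0).
Qed.

Let mpsi k : measurable_fun setT (fun w : hT k => psi k w).
Proof.
apply: measurable_fun_invr_ge0; first by apply: measurable_funD => //; exact: mm.
by move=> w; rewrite addr_ge0.
Qed.

Let mpsiT k : measurable_fun setT (psi k).
Proof. exact: (toT (@mpsi k)). Qed.

Let minc k : measurable_fun setT (inc k).
Proof.
apply: measurable_funM => //; apply: measurable_funM; apply: measurable_funX => //.
exact: measurable_funB.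
Qed.

Let inc_ge0 k w : 0 <= inc k w.
Proof. by have /andP[p0 _] := psi01 k.+1 w; rewrite mulr_ge0// mulr_ge0// sqr_ge0. Qed.

(* [1 / (1 + m') = 1 / (1 + m) - (m' - m) / (1 + m)^2
                  + (m' - m)^2 / ((1 + m)^2 (1 + m'))], and the linear term has mean 0. *)
Let potential_step k :
  (\int[P]_w (psi k.+1 w)%:E = \int[P]_w (psi k w)%:E + \int[P]_w (inc k w)%:E)%E.
Proof.
pose th (w : T) := psi k w ^+ 2.
have th01 w : 0 <= th w <= 1.
  by have /andP[p0 p1] := psi01 k w; rewrite sqr_ge0/= expr_le1.
have th0 w : 0 <= th w by have /andP[] := th01 w.
have mth : measurable_fun setT th by exact: measurable_funX.
have X_fin : (\int[P]_w (th w * (U * J k w (C k.+1 w)))%:E)%E \is a fin_num.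
  apply: (@bounded_fin_num _ (U * B)); first exact: measurable_funM.
  move=> w; have /andP[t0 t1] := th01 w; rewrite mulr_ge0//=.
  by rewrite -[leRHS]mul1r ler_pM// ler_pM2l.
rewrite -[LHS](addeK _ X_fin) -[RHS](addeK _ X_fin); congr (_ - _)%E.
rewrite -[in LHS](expected_increment0 (th := th))//; last first.
  by apply: measurable_funX; exact: mpsi.
have p0 j w : (0 <= (psi j w)%:E)%E by rewrite lee_fin; have /andP[] := psi01 j w.
rewrite -!ge0_integralD//.
- apply: eq_integral => w _; rewrite -!EFinD; congr (_%:E).
  rewrite /inc /th /psi.
  have h0' : 1 + m k w != 0 by rewrite gt_eqF// ltr_pwDl.
  have h1' : 1 + m k.+1 w != 0 by rewrite gt_eqF// ltr_pwDl.
  have -> : U * (eps k w)%:R * vol (C k.+1 w) =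
      m k.+1 w - m k w + U * J k w (C k.+1 w) by rewrite mS; ring.
  by field; rewrite h0' h1'.
- by move=> w _; rewrite adde_ge0// lee_fin.
- by apply/measurable_EFinP; exact: measurable_funD.
- by move=> w _; rewrite lee_fin mulr_ge0.
- by apply/measurable_EFinP; exact: measurable_funM.
- exact/measurable_EFinP.
- by move=> w _; rewrite lee_fin.
- exact/measurable_EFinP.
- exact/measurable_EFinP.
- by move=> w _; rewrite lee_fin mulr_ge0.
- by apply/measurable_EFinP; exact: measurable_funM.
Qed.

Lemma sum_increments_le1 N : (\sum_(0 <= k < N) \int[P]_w (inc k w)%:E <= 1)%E.
Proof.
have -> : (\sum_(0 <= k < N) \int[P]_w (inc k w)%:E =
    \int[P]_w (psi N w)%:E - \int[P]_w (psi 0 w)%:E)%E.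
  have fin k : (\int[P]_w (psi k w)%:E)%E \is a fin_num by exact: (@bounded_fin_num _ 1).
  elim: N => [|N IH]; first by rewrite big_nil subee.
  by rewrite big_nat_recr//= IH potential_step addeAC.
apply: (@le_trans _ _ (\int[P]_w (psi N w)%:E)%E).
  rewrite leeBlDr//; last exact: (@bounded_fin_num _ 1).
  by rewrite leeDl// integral_ge0// => w _; rewrite lee_fin; have /andP[] := psi01 0 w.
apply: (@le_trans _ _ (\int[P]_w 1%:E)%E); last by rewrite integral_prob_cst.
apply: ge0_le_integral => //.
- by move=> w _; rewrite lee_fin; have /andP[] := psi01 N w.
- exact/measurable_EFinP.
- by move=> w _; rewrite lee_fin; have /andP[] := psi01 N w.
Qed.

(** * Events that occur at bounded mass *)

Let light K k : set T := [set w | eps k w /\ m k w <= K].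

Let measurable_light K k : measurable (light K k).
Proof.
apply: measurableI.
  by have := @mepsT k measurableT [set true] I; rewrite setTI.
have := @mmT k measurableT _ (measurable_itv `]-oo, K]); by rewrite setTI.
Qed.

(** [U ^+ 2] comes from the jump [U * g], [(1 + K) ^+ 2] from the mass before the event, and
    [1 + K + U * B] from the mass after it, a jump being at most [U * B]. *)
Definition escape_const (K : R) : R :=
  @interface_const R n r K * (U ^+ 2 / ((1 + K) ^+ 2 * (1 + K + U * B))).

Let B_ge0 : 0 <= B.
Proof. by rewrite exprn_ge0// mulrn_wge0// ltW. Qed.

Let escape_const_gt0 (K : R) : 0 < K -> 0 < escape_const K.
Proof.
move=> K0; have UB : 0 <= U * B by rewrite mulr_ge0// ltW.
have b0 : 0 < @half_ball_bound R n r / 2 by rewrite divr_gt0// exprn_gt0// divr_gt0.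
have K1 : 0 < 1 + K by rewrite addr_gt0.
rewrite mulr_gt0//.
  by rewrite lt_min exprn_gt0//= divr_gt0// exprn_gt0.
by rewrite divr_gt0 ?exprn_gt0// mulr_gt0 ?exprn_gt0// ltr_wpDr.
Qed.

Let low K k w : R := (m k w <= K)%R%:R.

Let low_ge0 K k w : 0 <= low K k w. Proof. by []. Qed.

Let mlow K k : measurable_fun setT (fun z : hT k * borel_rV R n.+1 => low K k z.1).
Proof.
have ml : measurable_fun setT (fun w : hT k => m k w <= K).
  by apply: measurable_fun_ler; [exact: mm|exact: measurable_cst].
apply: (measurableT_comp (f := fun b : bool => b%:R : R)) => //.
exact: (measurableT_comp ml measurable_fst).
Qed.

Let mg k : measurable_fun setT (fun z : hT k * borel_rV R n.+1 => g k z.1 z.2).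
Proof.
have -> : (fun z : hT k * borel_rV R n.+1 => g k z.1 z.2) =
    (fun z => vol z.2 - J k z.1 z.2).
  by apply/funext => z; rewrite -(gJ k z.1) addrK.
apply: measurable_funB; last exact: mJ.
exact: (measurableT_comp mvol measurable_snd).
Qed.

Let increment_ge (K : R) k w : 0 < K ->
  low K k w * (U ^+ 2 / ((1 + K) ^+ 2 * (1 + K + U * B))) * g k w (C k.+1 w) ^+ 2 *
    (eps k w)%:R <= inc k w.
Proof.
move=> K0; rewrite /low; case: (leP (m k w) K) => mK; last by rewrite !mul0r.
case: (boolP (eps k w)) => ek; last by rewrite mulr0.
rewrite mul1r mulr1 /inc.
have -> : m k.+1 w - m k w = U * g k w (C k.+1 w).
  by rewrite mS ek mulr1 -(gJ k w); ring.
have m1 : m k.+1 w <= K + U * B.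
  rewrite mS ek mulr1 -addrA lerD// lerBlDr (le_trans (_ : _ <= U * B))//.
    by rewrite ler_pM2l//; have /andP[] := vol01 (C k.+1 w).
  by rewrite lerDl.
have UB : 0 <= U * B by rewrite mulr_ge0// ltW.
have K1 : 0 < 1 + K by rewrite addr_gt0.
have mk1 : 0 < 1 + m k w by rewrite ltr_pwDl.
have mk2 : 0 < 1 + m k.+1 w by rewrite ltr_pwDl.
have le1 : ((1 + K) ^+ 2)^-1 <= psi k w ^+ 2.
  rewrite /psi exprVn lef_pV2 ?posrE ?exprn_gt0//.
  by rewrite ler_sqr ?nnegrE ?(ltW K1) ?(ltW mk1)// lerD2l.
have le2 : (1 + K + U * B)^-1 <= psi k.+1 w.
  by rewrite /psi lef_pV2 ?posrE// -?addrA ?lerD2l// addrA ltr_wpDr.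
rewrite mulrAC -exprMn -mulrA ler_wpM2l ?sqr_ge0// invfM.
by rewrite ler_pM// invr_ge0 ?sqr_ge0// addr_ge0// ltW.
Qed.

(** Given the past, both sides are bounded through integrals against [Y k w b / L]: with weight
    [low] for the probability, and with weight [low * cK * g ^ 2], obtained from [increment_ge], for
    [inc]. Once the common factor [1 / L] is removed, [interface_energy] compares them. *)
Lemma light_event_probability (K : R) k : 0 < K ->
  ((escape_const K)%:E * P (light K k) <= \int[P]_w (inc k w)%:E)%E.
Proof.
move=> K0; set cK := U ^+ 2 / ((1 + K) ^+ 2 * (1 + K + U * B)).
have UB : 0 <= U * B by rewrite mulr_ge0// ltW.
have cK0 : 0 <= cK by rewrite divr_ge0 ?sqr_ge0// mulr_ge0 ?sqr_ge0// addr_ge0// addr_ge0// ltW.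
have -> : P (light K k) =
    (\int[P]_w \int[lam]_b (low K k w * Y k w b * @h k (w, b))%:E)%E.
  rewrite -(integral_event (K := fun z => low K k z.1))//.
  rewrite -(setIT (light K k)) -integral_indic//; apply: eq_integral => w _.
  rewrite indicE /low -natrM mulnb; congr (_%:R%:E); congr nat_of_bool.
  apply/idP/andP; first by move=> /set_mem[? ?].
  by move=> [? ?]; exact: mem_set.
pose K2 (z : hT k * borel_rV R n.+1) := low K k z.1 * cK * g k z.1 z.2 ^+ 2.
have mK2 : measurable_fun setT K2.
  apply: measurable_funM; first exact: measurable_funM.
  by apply: measurable_funX; exact: mg.
have K20 z : 0 <= K2 z by rewrite mulr_ge0 ?sqr_ge0// mulr_ge0.
have mi : measurable_fun setT (fun w : T => (w : hT k, C k.+1 w)).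
  apply: measurable_fun_pair => // _ A mA; rewrite setTI.
  exact: (@history_measurable k).
apply: (@le_trans _ _ (\int[P]_w (K2 (w, C k.+1 w) * (eps k w)%:R)%:E)%E); last first.
  apply: ge0_le_integral => //.
  - by move=> w _; rewrite lee_fin mulr_ge0.
  - by apply/measurable_EFinP; apply: measurable_funM => //; exact: (measurableT_comp mK2 mi).
  - exact/measurable_EFinP.
  - by move=> w _; rewrite lee_fin; exact: increment_ge.
rewrite (integral_event (K := K2))//.
have mI (f : hT k * borel_rV R n.+1 -> R) : measurable_fun setT f -> (forall z, 0 <= f z) ->
    measurable_fun setT (fun w : T => \int[lam]_b (f (w, b) * Y k w b * @h k (w, b))%:E)%E.
  move=> mf f0; apply: (@toT k).
  apply: (@measurable_fun_fubini_tonelli_F _ _ (hT k) (borel_rV R n.+1) R lam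
    (fun z => (f z * Y k z.1 z.2 * @h k z)%:E)).
    apply/measurable_EFinP; apply: measurable_funM; last exact: mh.
    by apply: measurable_funM => //; exact: mY.
  by move=> z; rewrite lee_fin mulr_ge0// mulr_ge0.
have I0 (f : hT k * borel_rV R n.+1 -> R) w : (forall z, 0 <= f z) ->
    (0 <= \int[lam]_b (f (w, b) * Y k w b * @h k (w, b))%:E)%E.
  by move=> f0; apply: integral_ge0 => b _; rewrite lee_fin mulr_ge0// mulr_ge0.
have e0 := ltW (escape_const_gt0 K0).
have mI1 := mI (fun z => low K k z.1) (@mlow K k) (fun=> low_ge0 _ _ _).
rewrite -ge0_integralZl_EFin//; last by move=> w _; exact: (I0 (fun z => low K k z.1)).
apply: ge0_le_integral => //.
- by move=> w _; rewrite mule_ge0 ?lee_fin//; exact: (I0 (fun z => low K k z.1)).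
- exact: measurable_funeM.
- exact: (mI K2).
move=> w _; rewrite /K2 /low/=.
case: (leP (m k w) K) => mK; last first.
  rewrite integral0_eq ?mule0; last by move=> b _; rewrite !mul0r.
  by apply: integral_ge0 => b _; rewrite lee_fin !mul0r.
pose L := fine (lam (reach k w)).
have hE b : Y k w b * @h k (w, b) = L^-1 * Y k w b.
  rewrite /h/= -/L; have [->|Yb] := eqVneq (Y k w b) 0; first by rewrite mul0r mulr0.
  by rewrite indicE mem_set ?mul1r 1?mulrC//; exact: reach_mem Yb.
have L0 : 0 <= L^-1 by rewrite invr_ge0 fine_ge0.
have mYg : measurable_fun setT (fun b : borel_rV R n.+1 => Y k w b * g k w b ^+ 2).
  apply: measurable_funM => //; apply: measurable_funX.
  exact: (measurableT_comp (@mg k) (@measurable_pair1 _ _ (hT k) (borel_rV R n.+1) w)).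
under eq_integral do rewrite mul1r hE EFinM.
rewrite ge0_integralZl_EFin//; last 2 first.
- by move=> b _; rewrite lee_fin.
- exact/measurable_EFinP.
have -> : (\int[lam]_b (1 * cK * g k w b ^+ 2 * Y k w b * @h k (w, b))%:E =
    (cK * L^-1)%:E * \int[lam]_b (Y k w b * g k w b ^+ 2)%:E)%E.
  have q0 : 0 <= cK * L^-1 by rewrite mulr_ge0.
  rewrite -ge0_integralZl_EFin//; last 2 first.
  - by move=> b _; rewrite lee_fin mulr_ge0// sqr_ge0.
  - exact/measurable_EFinP.
  apply: eq_integral => b _; rewrite -EFinM; congr (_%:E).
  by rewrite -mulrA hE; ring.
have [S YS] : exists S, forall x : 'rV[R]_n.+1, Y k w x != 0 -> x ord0 ord0 <= S.
  exact: chain_path_bounded.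
have := interface_energy lam_box r_gt0 (mYw k w) (Y01 k w) YS K0.
rewrite -/(Y k w) => energy.
have {}energy : ((@interface_const R n r K)%:E * \int[lam]_x (Y k w x)%:E <=
    \int[lam]_x (Y k w x * g k w x ^+ 2)%:E)%E.
  apply: energy; have -> : (\int[lam]_x (Y k w x)%:E = (m k w)%:E)%E.
    by rewrite fineK//; exact: chain_mass_fin_num.
  by rewrite lee_fin.
rewrite /escape_const -/cK.
rewrite muleA -EFinM.
have -> : @interface_const R n r K * cK * L^-1 = (cK * L^-1) * @interface_const R n r K by ring.
by rewrite EFinM -muleA lee_wpmul2l// lee_fin mulr_ge0.
Qed.

Lemma light_event_io (K : R) : 0 < K -> P (lim_sup_set (light K)) = 0%E.
Proof.
move=> K0; apply: lim_sup_set_cvg0 => //.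
have e0 := escape_const_gt0 K0.
apply: (@le_lt_trans _ _ ((escape_const K)^-1)%:E); last exact: ltry.
apply: lime_le; first by apply: is_cvg_nneseries => *; exact: measure_ge0.
apply: nearW => N /=.
rewrite -[leRHS]mule1 lee_pdivlMl//.
rewrite ge0_sume_distrr; last by move=> k _; exact: measure_ge0.
apply: le_trans (sum_increments_le1 N); apply: lee_sum => k _.
exact: light_event_probability.
Qed.

(** * Masses that stay above a level *)

Let heavy K N : set T := \bigcap_(k in [set k | (N <= k)%N]) [set w | K < m k w].

Let mheavy K N : measurable (heavy K N).
Proof.
apply: bigcap_measurable => [|k _]; first by exists N => /=.
by have := @mmT k measurableT _ (measurable_itv `]K, +oo[);
  rewrite setTI preimage_itvoy.
Qed.

(** [heavy K j] increases with [j] and lies in the event [K < m j], so Markov's inequality at the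
    single time [j], with the constant expectation, bounds each of these sets; continuity from below
    gives the union. *)
Let heavy_le (K : R) : 0 < K -> (K%:E * P (\bigcup_N heavy K N) <= \int[P]_w (m 0 w)%:E)%E.
Proof.
move=> K0; rewrite muleC -lee_pdivlMr//.
have mU : measurable (\bigcup_N heavy K N) by exact: bigcupT_measurable.
have cv : (P \o heavy K) n @[n --> \oo] --> P (\bigcup_N heavy K N).
  apply: nondecreasing_cvg_mu => // i j ij; apply/subsetPset => w hw k /= jk.
  by apply: hw => /=; exact: leq_trans jk.
rewrite -(cvg_lim _ cv)//; apply: lime_le; first by apply/cvg_ex; eexists; exact: cv.
apply: nearW => j /=; rewrite lee_pdivlMr// muleC.
rewrite -(expected_mass j) -(setIT (heavy K j)) -integral_indic//.
rewrite -ge0_integralZl_EFin ?(ltW K0)//; last by apply/measurable_EFinP; exact: measurable_indic.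
apply: ge0_le_integral => //.
- by move=> w _; rewrite -EFinM lee_fin mulr_ge0// ltW.
- by apply: measurable_funeM; apply/measurable_EFinP; exact: measurable_indic.
- exact/measurable_EFinP.
move=> w _; rewrite -EFinM lee_fin indicE.
case: (boolP (w \in _)) => [/set_mem hw|_]; last by rewrite mulr0.
by rewrite mulr1 ltW//; apply: hw => /=.
Qed.

(* Between two events the mass cannot increase, so a bound that is exceeded at
   every late event is exceeded at every late time. *)
Let event_io_heavy (K : R) w : lim_sup_set (fun k => [set w | eps k w = true]) w ->
  ~ lim_sup_set (light K) w -> (\bigcup_N heavy K N) w.
Proof.
move=> io nlight.
have [N hN] : exists N, forall k, (N <= k)%N -> eps k w -> K < m k w.
  apply: contrapT => nN; apply: nlight => N _; apply: contrapT => nl; apply: nN.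
  exists N => k Nk ek; rewrite ltNge; apply/negP => mk; apply: nl.
  by exists k => //=; split.
exists N => // k /= Nk.
have [j /= kj ej] := io k I.
(* Descending induction from an event time [j >= k] down to [k]: at each earlier time either an
   event occurs, and [hN] applies, or the next mass is no larger than the present one. *)
move: Nk; rewrite -(subKn kj); move: (j - k)%N (leq_subr k j) => i.
elim: i => [|i IH] ij; first by rewrite subn0 => Nj; exact: hN.
move=> Nk; have ji : (j - i = (j - i.+1).+1)%N by rewrite subnSK.
case: (boolP (eps (j - i.+1)%N w)) => e; first exact: hN.
have : K < m (j - i)%N w by apply: IH; [exact: ltnW|rewrite ji (leq_trans Nk)].
move=> /lt_le_trans; apply; rewrite ji mS (negbTE e) mulr0 mul0r addr0 gerBl.
by rewrite mulr_ge0// ltW.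
Qed.

Lemma event_io_null : P (lim_sup_set (fun k => [set w | eps k w = true])) = 0%E.
Proof.
set A := lim_sup_set _.
have mA : measurable A.
  apply: bigcapT_measurable => i; apply: bigcup_measurable => k _.
  by have := @mepsT k measurableT [set true] I; rewrite setTI.
apply: measure_negligible => //.
pose H := \bigcap_j \bigcup_N heavy j.+1%:R N.
have mH : measurable H.
  by apply: bigcapT_measurable => j; exact: bigcupT_measurable.
apply: (@negligibleS _ _ _ _ ((\bigcup_j lim_sup_set (light j.+1%:R)) `|` H)).
  move=> w Aw; have [[j lj]|nl] := pselect (exists j, lim_sup_set (light j.+1%:R) w).
    by left; exists j.
  right=> j _; apply: event_io_heavy => // lj; by apply: nl; exists j.
apply: negligibleU.
  apply: negligible_bigcup => j; apply/negligibleP; last by exact: light_event_io.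
  by apply: bigcapT_measurable => i; apply: bigcup_measurable.
apply/negligibleP => //.
have M_fin : (\int[P]_w (m 0 w)%:E)%E \is a fin_num.
  (* The initial profile is deterministic, so [m 0] is constant and its value at [point] bounds
     it. *)
  apply: (@bounded_fin_num _ (m 0 point)) => // w.
  by rewrite m_ge0/= lexx.
have Hj j : (j.+1%:R%:E * P H <= \int[P]_w (m 0 w)%:E)%E.
  apply: le_trans (heavy_le (ltr0Sn R j)); apply: lee_wpmul2l => //.
  apply: le_measure; rewrite ?inE//; last exact: bigcap_inf.
  exact: bigcupT_measurable.
apply/eqP; rewrite eq_le measure_ge0 andbT leNgt; apply/negP => PH.
have PHE : P H = (fine (P H))%:E by rewrite fineK// fin_num_measure.
have p0 : 0 < fine (P H) by rewrite -lte_fin -PHE.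
(* This level times [P H] exceeds the expected initial mass, a contradiction. *)
have := Hj (Num.truncn (fine (\int[P]_w (m 0 w)%:E)%E / fine (P H))).
rewrite PHE -(fineK M_fin) -EFinM lee_fin leNgt => /negP; apply.
by rewrite -ltr_pdivrMr// truncnS_gt.
Qed.

End chain_law.

(** Serves the case [a = 0], in which the profile stays at 0 and even a threshold equal to 0
    triggers no event. *)
Lemma null_event_type {R : realType} {d : nat} (r U : R) (f0 : 'rV[R]_d -> R)
    (c : nat -> 'rV[R]_d) (v : nat -> R) k : (forall x, f0 x = 0) ->
  event_type (chain_path r U f0 c v k) (c k.+1) (v k.+1) = false.
Proof.
move=> f00; rewrite /event_type; case: asboolP => // h; exfalso; apply: h.
elim: k => [//|k IH] x /=.
by rewrite /update /event_type asboolT//= IH subrr mulr0 addr0.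
Qed.

Theorem proposition4p11 (R : realType) (d : nat) (r U a r0 : R)
    (C0 cstar : 'rV[R]_d)
    (disp : measure_display) (T : measurableType disp) (P : probability T R)
    (C : nat -> {RV P >-> borel_rV R d}) (V : nat -> {RV P >-> R}) :
  (1 <= d)%N -> 0 < r -> 0 < U -> U < 1 -> 0 <= a -> a <= 1 -> 0 < r0 ->
  let Y0 := fun x : 'rV[R]_d => a * \1_(eball C0 r0) x in
  is_chain r U cstar Y0 C V ->
  P (lim_sup_set (fun n => [set w | epsS r U Y0 C V n w = true])) = 0%E.
Proof.
case: d C0 cstar C => // n C0 cstar C _ r_gt0 U_gt0 U_lt1 a_ge0 a_le1 r0_gt0 Y0 chain.
have [lam [lamE lam_box]] := @lebesgue_rV_measure R n.+1.
move: a_ge0; rewrite le_eqVlt => /predU1P[a0|a_gt0]; last first.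
  exact: (event_io_null r_gt0 U_gt0 U_lt1 a_gt0 a_le1 r0_gt0 chain lamE lam_box).
rewrite [X in P X](_ : _ = set0) ?measure0//; apply/seteqP; split=> // w io.
have [k _ /=] := io 0%N I.
by rewrite /epsS null_event_type// => x; rewrite /Y0 -a0 mul0r.
Qed.
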